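(* The Gromov–Hausdorff distance between the unit spheres $\mathbb{S}^3$ and $\mathbb{S}^4$, each endowed with its geodesic metric, is $$d_{\mathrm{GH}}(\mathbb{S}^3,\mathbb{S}^4)=\frac12\zeta_3,\qquad\text{where }\zeta_3=\arccos\left(\frac{-1}{4}\right).$$
   Context: For $k\in\mathbb{N}=\{1,2,\dots\}$, $\mathbb{S}^k=\{x\in\mathbb{R}^{k+1}:\sum_{i=1}^{k+1}x_i^2=1\}$ is endowed with the geodesic metric $d_{\mathbb{S}^k}(x,y)=\arccos(\langle x,y\rangle)\in[0,\pi]$, where $\langle\cdot,\cdot\rangle$ is the Euclidean inner product. For nonempty subsets $A,B$ of a metric space $(Z,d_Z)$, the Hausdorff distance is $d_{\mathrm{H}}^Z(A,B)=\max\left(\sup_{a\in A}d_Z(a,B),\sup_{b\in B}d_Z(b,A)\right)$, where $d_Z(a,B)=\inf_{b\in B}d_Z(a,b)$. The Gromov–Hausdorff distance $d_{\mathrm{GH}}(X,Y)$ between nonempty metric spaces $X,Y$ is the infimum of $d_{\mathrm{H}}^Z(X',Y')$ over all metric spaces $Z$ and all subspaces $X',Y'\subseteq Z$ with $X'$ isometric to $X$ and $Y'$ isometric to $Y$. *)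

(* Defs.v *)
From HB Require Import structures.
From mathcomp Require Import all_boot all_order all_algebra.
From mathcomp Require Import all_classical all_reals all_analysis.
From mathcomp Require Import ring lra.

Set Implicit Arguments.
Unset Strict Implicit.
Unset Printing Implicit Defensive.

Import Order.TTheory GRing.Theory Num.Theory.

Local Open Scope classical_set_scope.
Local Open Scope ring_scope.

(* The norm and topology that the library puts on 'rV[R]_n come from the sup
   norm, so the Euclidean inner product is defined here. *)
Definition inner (R : realType) (n : nat) (x y : 'rV[R]_n) : R :=
  \sum_(i < n) x ord0 i * y ord0 i.

Section inner_theory.
Context {R : realType} {n : nat}.
Implicit Types x y z : 'rV[R]_n.

Lemma innerC x y : inner x y = inner y x.
Proof. by apply: eq_bigr => i _; rewrite mulrC. Qed.

Lemma innerDl x y z : inner (x + y) z = inner x z + inner y z.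
Proof. by rewrite -big_split; apply: eq_bigr => i _; rewrite mxE mulrDl. Qed.

Lemma innerZl a x y : inner (a *: x) y = a * inner x y.
Proof. by rewrite mulr_sumr; apply: eq_bigr => i _; rewrite mxE mulrA. Qed.

Lemma innerDr x y z : inner z (x + y) = inner z x + inner z y.
Proof. by rewrite innerC innerDl !(innerC z). Qed.

Lemma innerZr a x y : inner y (a *: x) = a * inner y x.
Proof. by rewrite innerC innerZl (innerC y). Qed.

Lemma inner_ge0 x : 0 <= inner x x.
Proof. by apply: sumr_ge0 => i _; rewrite -expr2 sqr_ge0. Qed.

Lemma inner_eq0 x : inner x x = 0 -> x = 0.
Proof.
move=> xx0; apply/rowP => i; rewrite mxE.
have xx_ge0 (j : 'I_n) : true -> 0 <= x ord0 j * x ord0 j.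
  by move=> _; rewrite -expr2 sqr_ge0.
have /eqP : x ord0 i * x ord0 i = 0 by exact: (psumr_eq0P xx_ge0 xx0).
by rewrite mulf_eq0 orbb => /eqP.
Qed.

Lemma inner0l x : inner 0 x = 0.
Proof. by rewrite -(scale0r x) innerZl mul0r. Qed.

Lemma inner_lower x y s t : 0 <= s -> 0 <= t ->
  inner x x = s ^+ 2 -> inner y y = t ^+ 2 -> - (s * t) <= inner x y.
Proof.
move=> s0 t0 xs yt.
have [s_eq0|s_neq0] := eqVneq s 0.
  have -> : x = 0 by apply: inner_eq0; rewrite xs s_eq0 expr0n.
  by rewrite s_eq0 mul0r oppr0 inner0l.
have [t_eq0|t_neq0] := eqVneq t 0.
  have -> : y = 0 by apply: inner_eq0; rewrite yt t_eq0 expr0n.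
  by rewrite t_eq0 mulr0 oppr0 innerC inner0l.
have st : 0 < s * t by rewrite mulr_gt0// lt_neqAle eq_sym ?s_neq0 ?t_neq0.
have := inner_ge0 (t *: x + s *: y).
rewrite !(innerDl, innerDr, innerZl, innerZr) xs yt (innerC y x) => h.
have : 0 <= (s * t) * (s * t + inner x y) by lra.
by rewrite pmulr_rge0// => ?; lra.
Qed.

End inner_theory.

Record sphere (R : realType) (k : nat) := Sphere {
  sphere_val :> 'rV[R]_k.+1 ;
  sphere_valP : \sum_(i < k.+1) sphere_val ord0 i ^+ 2 == 1 }.

HB.instance Definition _ (R : realType) (k : nat) :=
  [isSub for @sphere_val R k].
HB.instance Definition _ (R : realType) (k : nat) :=
  [Choice of sphere R k by <:].

Definition geodesic (R : realType) (k : nat) (x y : sphere R k) : R :=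
  acos (inner x y).

Section geodesic_metric.
Context {R : realType} {k : nat}.
Implicit Types x y z : sphere R k.

Lemma inner_sphere x : inner x x = 1.
Proof. by rewrite -(eqP (sphere_valP x)); apply: eq_bigr => i _; rewrite expr2. Qed.

Lemma inner_sphere_itv x y : -1 <= inner x y <= 1.
Proof.
have := inner_ge0 (sphere_val x + sphere_val y).
have := inner_ge0 (sphere_val x + (-1) *: sphere_val y).
rewrite !(innerDl, innerDr, innerZl, innerZr) !inner_sphere.
rewrite (innerC (sphere_val y)) => ? ?.
by apply/andP; split; lra.
Qed.

Lemma cos_geodesic x y : cos (geodesic x y) = inner x y.
Proof. by have [] := acos_def (inner_sphere_itv x y). Qed.

Lemma geodesic_itv x y : 0 <= geodesic x y <= pi.
Proof. by have [] := acos_def (inner_sphere_itv x y). Qed.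

Lemma geodesicxx x : geodesic x x = 0.
Proof. by rewrite /geodesic inner_sphere acos1. Qed.

Lemma geodesic_positivity x y : geodesic x y = 0 -> x = y.
Proof.
move=> xy0; have := cos_geodesic x y; rewrite xy0 cos0 => xy1.
apply/val_inj/eqP; rewrite -subr_eq0; apply/eqP/inner_eq0.
rewrite -scaleN1r !(innerDl, innerDr, innerZl, innerZr) !inner_sphere /=.
by rewrite (innerC (sphere_val y)) -xy1; lra.
Qed.

Lemma geodesic_sym x y : geodesic x y = geodesic y x.
Proof. by rewrite /geodesic innerC. Qed.

Lemma geodesic_triangle y x z :
  geodesic x z <= geodesic x y + geodesic y z.
Proof.
have /andP[a0 api] := geodesic_itv x y.
have /andP[b0 bpi] := geodesic_itv y z.
have /andP[c0 cpi] := geodesic_itv x z.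
have [ab|ab] := leP pi (geodesic x y + geodesic y z); first exact: le_trans ab.
rewrite leNgt -ltr_cos ?in_itv/= ?c0 ?addr_ge0 ?(ltW ab)// -leNgt.
rewrite cosD (cos_geodesic x z).
move: a0 api b0 bpi {c0 cpi ab}; set a := geodesic x y; set b := geodesic y z.
move=> a0 api b0 bpi.
have sa : 0 <= sin a by apply: sin_ge0_pi; rewrite a0 api.
have sb : 0 <= sin b by apply: sin_ge0_pi; rewrite b0 bpi.
have ca : cos a = inner x y by exact: cos_geodesic.
have cb : cos b = inner y z by exact: cos_geodesic.
have := @inner_lower R _ (sphere_val x + (- cos a) *: sphere_val y)
  (sphere_val z + (- cos b) *: sphere_val y) _ _ sa sb.
rewrite !(innerDl, innerDr, innerZl, innerZr) !inner_sphere.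
rewrite (innerC (sphere_val y) x) (innerC (sphere_val z) y) -ca -cb.
rewrite !sin2cos2 => h.
have {}h := h ltac:(ring) ltac:(ring).
lra.
Qed.

End geodesic_metric.

HB.instance Definition _ (R : realType) (k : nat) :=
  isMetric.Build R (sphere R k) geodesicxx geodesic_positivity geodesic_sym
    geodesic_triangle.

Lemma mdist_sphereE (R : realType) (k : nat) (x y : sphere R k) :
  mdist x y = acos (inner x y).
Proof. by []. Qed.

(* Infima and suprema are taken in \bar R, so that no boundedness hypothesis is
   needed; the values are the usual ones on nonempty sets. *)
Definition dist_set (R : realType) (Z : metricType R) (z : Z) (B : set Z) :
    \bar R :=
  ereal_inf [set (mdist z b)%:E | b in B].

Definition hausdorff_dist (R : realType) (Z : metricType R) (A B : set Z) :
    \bar R :=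
  Order.max (ereal_sup [set dist_set a B | a in A])
            (ereal_sup [set dist_set b A | b in B]).

Definition isometric_to (R : realType) (X Z : metricType R) (A : set Z) : Prop :=
  exists f : X -> Z,
    set_bij [set: X] A f /\ (forall x y : X, mdist (f x) (f y) = mdist x y).

Definition gromov_hausdorff (R : realType) (X Y : metricType R) : \bar R :=
  ereal_inf [set r | exists (Z : metricType R) (A B : set Z),
    [/\ isometric_to X A, isometric_to Y B & r = hausdorff_dist A B]].

(* Main.v *)
(* Lower bound. A map psi from S^4 to S^3 of distortion less than arccos(-1/4)
   can be made odd.  Push a finely subdivided, antipodally symmetric mod 2 cycle
   carried by S^4 through it: each assigned simplex has five unit vertices with
   pairwise inner products > -1/4, so its vertices lie in an open half-space,
   around their own sum.  Subdividing the assigned and labelling every point by its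
   largest coordinate, with sign, gives a labelling in the spirit of Tucker and
   Fan without complementary pairs, which the powers of the characteristic class
   of the antipodal action forbid.

   Upper bound. Let p_0, .., p_4 be a regular simplex inscribed in S^3.  A point
   (v, h) of the upper half of S^4 is sent to v if h = 0, to the p_j nearest to
   v if h >= 1/2, and to 3/4 p_j - 1/2 p_k if 0 < h <= 1/2, where p_j and p_k are
   nearest to and farthest from v.  Extended by the antipodal symmetry, this
   multivalued map has distortion arccos(-1/4); as it takes finitely many values
   off the equator, this is a finite list of bounds between cells. *)
From HB Require Import structures.
Require Import Defs.
From mathcomp Require Import all_boot all_order all_algebra.
From mathcomp Require Import all_classical all_reals all_analysis.
From mathcomp Require Import fingroup perm ring lra zify.

Set Implicit Arguments.
Unset Strict Implicit.
Unset Printing Implicit Defensive.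

Import Order.TTheory GRing.Theory Num.Theory.

Local Open Scope ring_scope.

(** * Mod 2 chains and barycentric subdivision *)

Section Z2Chains.

(** A mod 2 chain is an unreduced list of simplices, and a simplex is a list of vertices. Equality
    of chains mod 2 is expressed by letting every cochain [f] take the same value on both. *)
Definition ev (T : Type) (f : T -> bool) (c : seq T) : bool :=
  \big[addb/false]_(t <- c) f t.

(** This is the augmented boundary: the only face of a single vertex is the empty simplex. *)
Fixpoint bd (T : Type) (s : seq T) : seq (seq T) :=
  if s is x :: s' then s' :: map (cons x) (bd s') else [::].

Lemma ev_nil T (f : T -> bool) : ev f [::] = false.
Proof. exact: big_nil. Qed.

Lemma ev_cons T (f : T -> bool) t c : ev f (t :: c) = f t (+) ev f c.
Proof. exact: big_cons. Qed.

Lemma ev_cat T (f : T -> bool) c c' : ev f (c ++ c') = ev f c (+) ev f c'.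
Proof. exact: big_cat. Qed.

Lemma ev_map T U (g : T -> U) f c : ev f (map g c) = ev (fun t => f (g t)) c.
Proof. exact: big_map. Qed.

Lemma ev_flatten T U (g : T -> seq U) f c :
  ev f (flatten (map g c)) = ev (fun t => ev f (g t)) c.
Proof. by elim: c => [|t c IH] /=; rewrite ?ev_nil// ev_cat IH ev_cons. Qed.

Lemma ev_addb T (f g : T -> bool) c :
  ev (fun t => f t (+) g t) c = ev f c (+) ev g c.
Proof. exact: big_split. Qed.

Lemma ev_andb T b (f : T -> bool) c : ev (fun t => b && f t) c = b && ev f c.
Proof. by elim: c => [|t c IH]; rewrite ?ev_nil ?andbF// !ev_cons IH andb_addr. Qed.

Lemma eq_ev T (f g : T -> bool) c : f =1 g -> ev f c = ev g c.
Proof. by move=> fg; apply: eq_bigr => t _. Qed.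

Lemma eq_ev_in (T : eqType) (f g : T -> bool) c :
  {in c, f =1 g} -> ev f c = ev g c.
Proof. by move=> fg; apply: eq_big_seq. Qed.

Lemma bd_map T U (g : T -> U) s : bd (map g s) = map (map g) (bd s).
Proof. by elim: s => //= x s ->; rewrite -!map_comp. Qed.

Lemma size_bd (T : eqType) (s u : seq T) :
  u \in bd s -> size s = (size u).+1.
Proof.
elim: s u => //= x s IH u; rewrite inE => /predU1P[->//|/mapP[w ws ->]] /=.
by rewrite (IH w).
Qed.

Lemma mem_bd (T : eqType) (s u : seq T) : u \in bd s -> {subset u <= s}.
Proof.
elim: s u => //= x s IH u; rewrite inE => /predU1P[->|/mapP[w ws ->]] y.
  by rewrite inE orbC => ->.
by rewrite !inE => /predU1P[->|/(IH _ ws)->]; rewrite ?eqxx// orbT.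
Qed.

Lemma ev_bd_bd T (f : seq T -> bool) s :
  ev (fun u => ev f (bd u)) (bd s) = false.
Proof.
elim: s f => [|x s IH] f /=; first exact: ev_nil.
rewrite ev_cons ev_map /= -/(ev f (bd s)).
transitivity (ev f (bd s) (+)
    ev (fun u => f u (+) ev (fun w => f (x :: w)) (bd u)) (bd s)).
  by congr (_ (+) _); apply: eq_ev => u; rewrite ev_cons ev_map.
by rewrite ev_addb addbA addbb IH.
Qed.

End Z2Chains.

(** * Sorted labels and alternating signs *)

Section Alternation.
Variables (L : Type) (key : L -> nat) (sg : L -> bool).

Fixpoint insert (x : L) (s : seq L) : seq L :=
  if s is y :: s' then
    if (key x <= key y)%N then x :: s else y :: insert x s'
  else [:: x].

Definition isort (s : seq L) : seq L := foldr insert [::] s.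

Let sorted_key := sorted (fun x y => key x <= key y)%N.

Lemma sorted_insert x s : sorted_key s -> sorted_key (insert x s).
Proof.
case: s => // y s; elim: s y => [|z s IH] y.
  by move=> _ /=; case: leqP => /= [->//|/ltnW ->].
move=> /= /andP[yz zs]; case: ifP => [xy|/negbT]; first by rewrite /= xy yz.
rewrite -ltnNge => /ltnW yx; have := IH z zs; rewrite /=.
by case: ifP => /= [xz|xz] h; rewrite ?yx ?yz.
Qed.

Lemma sorted_isort s : sorted_key (isort s).
Proof. by elim: s => //= x s; exact: sorted_insert. Qed.

(** The order matters when the head of [s] is deleted: if [x] precedes the head, it also precedes
    the next entry. *)
Lemma ev_bd_insert (f : seq L -> bool) x s : sorted_key s ->
  ev f (bd (insert x s)) = f s (+) ev (fun u => f (insert x u)) (bd s).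
Proof.
elim: s f => [|y s IH] f /=; first by rewrite ev_cons !ev_nil.
move=> ys; have ss : sorted_key s by apply: path_sorted ys.
case: ifP => xy /=; rewrite !ev_cons !ev_map /= xy.
  congr (_ (+) (_ (+) _)).
  case: s ys {IH ss} => //= z s /andP[yz _].
  by rewrite (leq_trans xy yz).
by rewrite IH// addbA addbA; congr (_ (+) _); rewrite addbC.
Qed.

Lemma ev_bd_isort (f : seq L -> bool) s :
  ev f (bd (isort s)) = ev (fun u => f (isort u)) (bd s).
Proof.
elim: s f => [|x s IH] f /=; first by rewrite !ev_nil.
by rewrite ev_bd_insert ?sorted_isort// ev_cons ev_map IH.
Qed.

Definition alt (s : seq L) : bool := sorted (fun x y => sg x (+) sg y) s.

Definition posalt (s : seq L) : bool :=
  (if s is x :: _ then sg x else false) && alt s.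

(** Sign change is a mod 2 cocycle: the changes from [x] to [y] and from [x] to [z] add up to the
    change from [y] to [z]. This is the inductive step. *)
Lemma ev_alt_bd x s : s <> [::] ->
  ev (fun u => alt (x :: u)) (bd s) = alt s.
Proof.
elim: s x => // y s IH x _; rewrite /= ev_cons ev_map /=.
rewrite ev_andb; case: s IH => [|z s] IH /=; first by rewrite ev_nil andbF.
rewrite (IH y)//= /alt /=.
by case: (path _ z s); case: (sg x); case: (sg y); case: (sg z).
Qed.

(* [posalt] is the cup product of the 0-cochain "sign of the first label" with
   a power of its coboundary, whose coboundary is the next power. *)
Lemma ev_posalt_bd s : (1 < size s)%N -> ev posalt (bd s) = alt s.
Proof.
case: s => [|x [|y s]]// _.
have -> : bd [:: x, y & s] = (y :: s) :: map (cons x) (bd (y :: s)) by [].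
rewrite ev_cons ev_map.
rewrite /posalt ev_andb ev_alt_bd// /alt /=.
by case: (path _ y s); case: (sg x); case: (sg y).
Qed.

End Alternation.

Lemma insert_map (L : Type) (key : L -> nat) (g : L -> L) x s :
  (forall y, key (g y) = key y) ->
  insert key (g x) (map g s) = map g (insert key x s).
Proof.
by move=> kg; elim: s => //= y s IH; rewrite !kg IH; case: ifP.
Qed.

Lemma isort_map (L : Type) (key : L -> nat) (g : L -> L) s :
  (forall y, key (g y) = key y) ->
  isort key (map g s) = map g (isort key s).
Proof. by move=> kg; elim: s => //= x s ->; rewrite insert_map. Qed.

Lemma perm_isort (L : eqType) (key : L -> nat) (s : seq L) :
  perm_eq (isort key s) s.
Proof.
elim: s => //= x s IH; apply: perm_trans (_ : perm_eq (x :: isort key s) _).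
  elim: (isort key s) => //= y t IHt; case: ifP => // _.
  apply: perm_trans (_ : perm_eq (y :: x :: t) _); first by rewrite perm_cons.
  by rewrite -[y :: x :: t]/([:: y] ++ [:: x] ++ t) perm_catCA.
by rewrite perm_cons.
Qed.

(** The model is a flag of hemispheres: the boundary of the hemisphere of dimension d+1 is the whole
    d-sphere, that is, a d-hemisphere plus its antipode. *)
Definition antipodal_chains (V : zmodType) (m : nat) (c : nat -> seq (seq V)) :=
  [/\ exists x, c 0 = [:: [:: x]],
      forall d s, (d <= m)%N -> s \in c d -> size s = d.+1 &
      forall d f, (d < m)%N -> ev (fun s => ev f (bd s)) (c d.+1) =
        ev f (c d) (+) ev (fun s => f (map -%R s)) (c d)].

(** * Parity of alternating simplices *)

Section Fan.
Variables (V : zmodType) (m : nat) (c : nat -> seq (seq V)).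
Variable lab : V -> nat * bool.
Hypothesis cP : antipodal_chains m c.
Hypothesis lab_odd : forall d s v, (d <= m)%N -> s \in c d -> v \in s ->
  lab (- v) = ((lab v).1, ~~ (lab v).2).

Let flip (p : nat * bool) := (p.1, ~~ p.2).
Let srt (s : seq V) := isort fst (map lab s).

Let size_srt s : size (srt s) = size s.
Proof. by rewrite (perm_size (perm_isort _ _)) size_map. Qed.

Let posalt_srtN s : (s <> [::]) -> (forall v, v \in s -> lab (- v) = flip (lab v)) ->
  posalt snd (srt s) (+) posalt snd (srt (map -%R s)) = alt snd (srt s).
Proof.
move=> s0 sN.
have -> : srt (map -%R s) = map flip (srt s).
  rewrite /srt -(isort_map (g := flip))// -!map_comp; congr (isort _ _).
  by apply/eq_in_map => v vs /=; rewrite sN.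
move: (size_srt s); case: (srt s) => [|x t]; first by case: s s0 {sN}.
move=> _; rewrite /posalt /alt /= path_map.
rewrite (@eq_path _ _ (fun x y => x.2 (+) y.2)); last first.
  by move=> y z /=; rewrite addbN addNb negbK.
by case: (x.2); case: (path _ x t).
Qed.

(** The alternating simplices of each [c d] are odd in number. [alt] is the coboundary of [posalt],
    so its sum over [c d.+1] is the sum of [posalt] over [c d] and its antipode; of an alternating
    simplex and its antipode exactly one starts with a positive sign. *)
Lemma ev_alt_antipodal d : (d <= m)%N ->
  ev (fun s => alt snd (srt s)) (c d) = true.
Proof.
have [[x c0] csz cbd] := cP.
elim: d => [|d IH] dm; first by rewrite c0 ev_cons ev_nil.
transitivity (ev (fun s => ev (fun u => posalt snd (srt u)) (bd s)) (c d.+1)).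
  apply: eq_ev_in => s sc.
  rewrite -ev_posalt_bd; last by rewrite size_srt (csz _ _ dm sc).
  by rewrite /srt ev_bd_isort bd_map ev_map.
rewrite cbd// -ev_addb -(IH (ltnW dm)); apply: eq_ev_in => s sc.
apply: posalt_srtN => [s0|v vs]; first by have := csz _ _ (ltnW dm) sc; rewrite s0.
exact: lab_odd (ltnW dm) sc vs.
Qed.

Lemma antipodal_chains_complementary :
  (forall s v, s \in c m -> v \in s -> ((lab v).1 < m)%N) ->
  (forall s u v, s \in c m -> u \in s -> v \in s ->
    (lab u).1 = (lab v).1 -> (lab u).2 = (lab v).2) -> False.
Proof.
move=> labm labs; have [_ csz _] := cP.
have [/hasP[s sc]|/hasPn noalt] := boolP (has (fun s => alt snd (srt s)) (c m)); last first.
  have := ev_alt_antipodal (leqnn m).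
  rewrite (@eq_ev_in _ _ (fun=> false)); first by rewrite /ev big1_eq.
  by move=> s /noalt /negbTE.
have srtP p : p \in srt s -> exists2 v, v \in s & p = lab v.
  by rewrite (perm_mem (perm_isort _ _)) => /mapP.
move: (size_srt s) (sorted_isort fst (map lab s)) srtP.
rewrite (csz _ _ (leqnn m) sc) -/(srt s); case: (srt s) => // x t [tm] xt tP.
rewrite /alt /= => ta.
(* Neighbours with equal keys would have equal signs, against alternation. So the m+1 keys are
   distinct, while only m values are available. *)
have : sorted ltn (map fst (x :: t)).
  have {tP} : {in x :: t &, forall p q, p.1 = q.1 -> p.2 = q.2}.
    by move=> _ _ /tP[u us ->] /tP[v vs ->]; exact: labs sc us vs.
  elim: t x xt ta {tm} => //= y t IH x /andP[xy yt] /andP[xy2 ya] tP.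
  rewrite IH// ?andbT => [|p q ps qs].
    rewrite ltn_neqAle xy andbT; apply/negP => /eqP /tP.
    by rewrite !inE !eqxx orbT => /(_ isT isT) e; rewrite e addbb in xy2.
  by apply: tP; rewrite inE ?ps ?qs orbT.
move=> /(sorted_uniq ltn_trans ltnn) /uniq_leq_size le_size.
suff /le_size : {subset map fst (x :: t) <= iota 0 m}.
  by rewrite /= size_map size_iota tm ltnn.
move=> _ /mapP[p /tP[v vs ->] ->]; rewrite mem_iota add0n.
exact: labm sc vs.
Qed.
End Fan.

(** * Barycentric subdivision as a chain map *)

Section Barycentric.
Variables (R : numFieldType) (V : lmodType R).
Implicit Types (t s : seq V).

Definition bary t : V := (size t)%:R^-1 *: \sum_(v <- t) v.

(** The cone from the barycentre over the subdivided boundary; [n] is fuel for a recursion that is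
    not structural in [t]. *)
Fixpoint sdn n t : seq (seq V) :=
  if n is n'.+1 then map (cons (bary t)) (flatten (map (sdn n') (bd t)))
  else [:: [::]].

Definition sd t := sdn (size t) t.

Definition sdc (c : seq (seq V)) := flatten (map sd c).

Lemma sdE t : t <> [::] -> sd t = map (cons (bary t)) (sdc (bd t)).
Proof.
case: t => // x t _; rewrite /sd [size _]/=; congr (map _ (flatten _)).
by apply/eq_in_map => s /size_bd[->].
Qed.

Lemma ev_sdc f c : ev f (sdc c) = ev (fun t => ev f (sd t)) c.
Proof. exact: ev_flatten. Qed.

(** The boundary of a cone is its base plus the cone over the boundary of the base. Here the base is
    the subdivided boundary of [t], a cycle by induction and [ev_bd_bd]. *)
Lemma ev_bd_sd f t :
  ev (fun u => ev f (bd u)) (sd t) = ev (fun u => ev f (sd u)) (bd t).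
Proof.
have [n] := ubnP (size t); elim: n f t => // n IH f [|x t] /ltnSE tn.
  by rewrite /= ev_cons !ev_nil.
rewrite sdE// ev_map.
transitivity (ev (fun u => f u (+)
    ev (fun w => f (bary (x :: t) :: w)) (bd u)) (sdc (bd (x :: t)))).
  by apply: eq_ev => u /=; rewrite ev_cons ev_map.
rewrite ev_addb !ev_sdc; set g := fun w => f _.
suff -> : ev (fun s => ev (fun u => ev g (bd u)) (sd s)) (bd (x :: t)) = false.
  by rewrite addbF.
rewrite -(ev_bd_bd (fun u => ev g (sd u)) (x :: t)).
by apply: eq_ev_in => s sb; apply: IH; rewrite -(size_bd sb).
Qed.

Lemma size_sd t s : s \in sd t -> size s = size t.
Proof.
have [n] := ubnP (size t); elim: n s t => // n IH s [|x t] /ltnSE tn.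
  by rewrite inE => /eqP ->.
rewrite sdE// => /mapP[u /flattenP[_ /mapP[w wb ->]] uw ->].
by rewrite (size_bd wb) /= (IH u w)// -(size_bd wb).
Qed.

Lemma baryN t : bary (map -%R t) = - bary t.
Proof. by rewrite /bary size_map big_map sumrN scalerN. Qed.

Lemma sdN t : sd (map -%R t) = map (map -%R) (sd t).
Proof.
have [n] := ubnP (size t); elim: n t => // n IH [|x t] /ltnSE tn//.
rewrite !sdE// baryN bd_map -!map_comp.
rewrite (_ : sdc (map _ _) = map (map -%R) (sdc (bd (x :: t)))); last first.
  rewrite /sdc map_flatten -!map_comp; congr flatten; apply/eq_in_map => s sb /=.
  by apply: IH; rewrite -(size_bd sb).
by rewrite -map_comp.
Qed.

Lemma antipodal_chains_sdc m c :
  antipodal_chains m c -> antipodal_chains m (fun d => sdc (c d)).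
Proof.
move=> [[x c0] csz cbd]; split => [|d s dm|d f dm].
- exists x; rewrite c0 /sdc /= /sd /= /bary big_seq1 /=.
  by rewrite invr1 scale1r.
- by move=> /flattenP[_ /mapP[t tc ->]] /size_sd ->; exact: csz dm tc.
rewrite !ev_sdc (eq_ev _ (ev_bd_sd f)) cbd//; congr (_ (+) _).
by apply: eq_ev => s; rewrite sdN ev_map.
Qed.

Section BaryClosed.
Variable K : V -> Prop.
Hypothesis Kbary : forall t, t <> [::] -> {in t, forall v, K v} -> K (bary t).

Lemma sd_bary_closed t s : {in t, forall v, K v} -> s \in sd t ->
  {in s, forall v, K v}.
Proof.
have [n] := ubnP (size t); elim: n s t => // n IH s [|x t] /ltnSE tn tK.
  by rewrite inE => /eqP ->.
rewrite sdE// => /mapP[u /flattenP[_ /mapP[w wb ->]] uw ->] v.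
rewrite inE => /predU1P[->|vu]; first exact: Kbary.
apply: (IH u w) => //; first by rewrite -(size_bd wb).
by move=> y /(mem_bd wb); exact: tK.
Qed.

End BaryClosed.
End Barycentric.

(** The push-forward acts on vertices alone, so a discontinuous odd map can be applied. *)
Lemma antipodal_chains_map (V W : zmodType) m c (g : V -> W) :
  (forall v, g (- v) = - g v) -> antipodal_chains m c ->
  antipodal_chains m (fun d => map (map g) (c d)).
Proof.
move=> gN [[x c0] csz cbd]; split => [|d s dm|d f dm].
- by exists (g x); rewrite c0.
- by move=> /mapP[t tc ->]; rewrite size_map (csz _ _ dm tc).
rewrite !ev_map.
transitivity (ev (fun s => ev (fun u => f (map g u)) (bd s)) (c d.+1)).
  by apply: eq_ev => s; rewrite bd_map ev_map.
rewrite cbd//; congr (_ (+) _); apply: eq_ev => s.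
by rewrite -!map_comp; congr (f _); apply: eq_map => v /=.
Qed.

(** * Mesh of iterated subdivisions, in the sup norm *)

Section Mesh.
Context {R : realType} {k : nat}.
Notation V := 'rV[R]_k.
Implicit Types (t s : seq V) (x y : V).

(** This stands in for convexity: sup-norm balls, half-spaces and hyperplanes qualify. *)
Definition bary_closed (K : V -> Prop) :=
  forall t, t <> [::] -> {in t, forall v, K v} -> K (bary t).

Definition close (r : R) s :=
  {in s &, forall x y i, `|x ord0 i - y ord0 i| <= r}.

Lemma bary_coord t i : bary t ord0 i = (size t)%:R^-1 * \sum_(v <- t) v ord0 i.
Proof.
rewrite /bary mxE; congr (_ * _); elim: t => [|v t IH]; first by rewrite !big_nil mxE.
by rewrite !big_cons mxE IH.
Qed.

Lemma mean_le (f : V -> R) t r : t <> [::] -> {in t, forall v, f v <= r} ->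
  (size t)%:R^-1 * \sum_(v <- t) f v <= r.
Proof.
move=> t0 tr; have n0 : 0 < (size t)%:R :> R by rewrite ltr0n; case: t t0 {tr}.
rewrite mulrC ler_pdivrMr// mulr_natr {n0 t0}.
elim: t tr => [|v t IH] tr; first by rewrite big_nil.
rewrite big_cons mulrS lerD ?tr ?mem_head// IH// => w wt.
by rewrite tr// inE wt orbT.
Qed.

Lemma mean_ge (f : V -> R) t r : t <> [::] -> {in t, forall v, r <= f v} ->
  r <= (size t)%:R^-1 * \sum_(v <- t) f v.
Proof.
move=> t0 tr; rewrite -lerN2 -mulrN -sumrN; apply: mean_le => // v vt.
by rewrite lerN2 tr.
Qed.

Lemma inner_bary t m :
  inner (bary t) m = (size t)%:R^-1 * \sum_(v <- t) inner v m.
Proof.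
rewrite /bary innerZl; congr (_ * _); elim: t => [|v t IH].
  by rewrite !big_nil inner0l.
by rewrite !big_cons innerDl IH.
Qed.

Lemma bary_closed_ball y r : bary_closed (fun x => forall i, `|y ord0 i - x ord0 i| <= r).
Proof.
move=> t t0 tr i; rewrite distrC ler_distl bary_coord; apply/andP; split.
  by apply: (mean_ge (f := fun v => v ord0 i)) => // v /tr/(_ i); rewrite distrC ler_distl => /andP[].
by apply: (mean_le (f := fun v => v ord0 i)) => // v /tr/(_ i); rewrite distrC ler_distl => /andP[].
Qed.

Lemma bary_closed_halfspace m r : bary_closed (fun x => r <= inner x m).
Proof. by move=> t t0 tr; rewrite inner_bary; apply: mean_ge. Qed.

Lemma bary_closed_hyperplane m r : bary_closed (fun x => inner x m = r).
Proof.
move=> t t0 tr; rewrite inner_bary; apply/eqP; rewrite eq_le.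
by rewrite mean_le ?mean_ge// => v /tr ->.
Qed.

(** In the average of the differences [w - v] the term [w = v] vanishes, which leaves at most n-1
    terms of size [r] out of n. *)
Lemma bary_dist t v r : v \in t -> close r t -> forall i,
  `|bary t ord0 i - v ord0 i| <= (1 - (size t)%:R^-1) * r.
Proof.
move=> vt tr i; have n0 : 0 < (size t)%:R :> R by rewrite ltr0n; case: t vt {tr}.
have -> : bary t ord0 i - v ord0 i =
    (size t)%:R^-1 * \sum_(w <- t) (w ord0 i - v ord0 i).
  rewrite big_split /= mulrDr -bary_coord; congr (_ + _).
  rewrite big_const_seq count_predT iter_addr addr0 -[(- _) *+ _]mulr_natr mulrCA mulVf ?mulr1//.
  by rewrite lt0r_neq0.
rewrite normrM ger0_norm ?invr_ge0 ?(ltW n0)// mulrC ler_pdivrMr// mulrAC mulrBl.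
rewrite mulVf ?lt0r_neq0// mul1r.
apply: le_trans (ler_norm_sum _ _ _) _.
rewrite (big_rem v)//= subrr normr0 add0r.
have -> : (size t)%:R - 1 = (size (rem v t))%:R :> R.
  by rewrite size_rem// -[in RHS]subn1 natrB// -has_predT; apply/hasP; exists v.
have {tr} : {in rem v t, forall w : V, `|w ord0 i - v ord0 i| <= r}.
  by move=> w /mem_rem wt; exact: tr.
elim: (rem v t) => [|w s IH] sr; first by rewrite big_nil mul0r.
rewrite big_cons [size _]/= -natr1 mulrDl mul1r addrC lerD ?sr ?mem_head//.
by rewrite IH// => x xs; rewrite sr// inE xs orbT.
Qed.

Lemma sd_close t s r (m : nat) : (size t <= m.+1)%N -> 0 <= r -> close r t ->
  s \in sd t -> close ((1 - m.+1%:R^-1) * r) s.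
Proof.
have [n] := ubnP (size t); elim: n s t => // n IH s [|x t] /ltnSE tn tm r0 tr.
  by rewrite inE => /eqP ->.
rewrite sdE// => /mapP[u /flattenP[_ /mapP[w wb ->]] uw ->].
have cu : close ((1 - m.+1%:R^-1) * r) u.
  apply: (IH u w) => //; rewrite -?(size_bd wb)//.
    by apply: leq_trans tm; rewrite (size_bd wb) leqnSn.
  by move=> y z /(mem_bd wb) ? /(mem_bd wb) ?; exact: tr.
have bu y : y \in u -> forall i,
    `|bary (x :: t) ord0 i - y ord0 i| <= (1 - m.+1%:R^-1) * r.
  apply: (sd_bary_closed (@bary_closed_ball (bary (x :: t)) _) _ uw) => v.
  move=> /(mem_bd wb) vt i; apply: le_trans (bary_dist vt tr i) _.
  by rewrite ler_wpM2r// lerD2l lerN2 lef_pV2 ?posrE ?ltr0n// ler_nat.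
move=> y z; rewrite !inE => /predU1P[->|yu] /predU1P[->|zu] i.
- by rewrite subrr normr0 mulr_ge0// subr_ge0 invf_le1 ?ltr0n// ler1n.
- exact: bu.
- by rewrite distrC; exact: bu.
- exact: cu.
Qed.

(* The last clause says that every simplex of the refinement lies in the convex
   hull of a simplex of the original chain. *)
Lemma subdivide m (c : nat -> seq (seq V)) r e : antipodal_chains m c ->
  (forall d s, (d <= m)%N -> s \in c d -> close r s) -> 0 < e ->
  exists c', [/\ antipodal_chains m c',
    forall d s, (d <= m)%N -> s \in c' d -> close e s &
    forall d s', (d <= m)%N -> s' \in c' d -> exists2 s, s \in c d &
      forall K, bary_closed K -> {in s, forall v, K v} -> {in s', forall v, K v}].
Proof.
move=> cP cr e0; pose q : R := 1 - m.+1%:R^-1.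
have q0 : 0 <= q by rewrite subr_ge0 invf_le1 ?ltr0n// ler1n.
have q1 : `|q| < 1 by rewrite ger0_norm// ltrBlDr ltrDl invr_gt0 ltr0n.
pose r' := Num.max r 0; have r'0 : 0 <= r' by rewrite le_max lexx orbT.
have [N qN] : exists N, r' * q ^+ N <= e.
  have /cvgrPdist_le/(_ e e0)[N _ /(_ N)/= /(_ (leqnn N))] := cvg_geometric r' q1.
  by rewrite sub0r normrN => h; exists N; apply: le_trans (ler_norm _) h.
pose it n d := iter n (@sdc R V) (c d).
suff [cN rN hN] : [/\ antipodal_chains m (it N),
    forall d s, (d <= m)%N -> s \in it N d -> close (r' * q ^+ N) s &
    forall d s', (d <= m)%N -> s' \in it N d -> exists2 s, s \in c d &
      forall K, bary_closed K -> {in s, forall v, K v} -> {in s', forall v, K v}].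
  exists (it N); split=> // d s dm sc x y xs ys i.
  exact: le_trans (rN _ _ dm sc _ _ xs ys i) qN.
elim: N {qN} => [|N [aN rN hN]].
  split=> // [d s dm sc x y xs ys i|d s dm sc]; last by exists s.
  by rewrite mulr1; apply: le_trans (cr _ _ dm sc _ _ xs ys i) _; rewrite le_max lexx.
split=> [|d s dm /flattenP[_ /mapP[t tc ->]] st|d s dm /flattenP[_ /mapP[t tc ->]] st].
- exact: antipodal_chains_sdc aN.
- rewrite exprSr mulrA mulrC; apply: (sd_close _ _ (rN _ _ dm tc) st).
    by have [_ sz _] := aN; rewrite (sz _ _ dm tc) ltnS.
  by rewrite mulr_ge0// exprn_ge0.
- have [w wc wK] := hN d t dm tc; exists w => // K Kc Kw.
  by have := sd_bary_closed Kc (wK K Kc Kw) st.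
Qed.

End Mesh.

(** * Hemispheres of the boundary of the cross-polytope *)

Section CrossPolytope.
Variables (R : realType) (m : nat).
Notation V := 'rV[R]_m.+1.

Let e d : V := delta_mx ord0 (inord d).

(** The upper half of the d-sphere is the cone from [e d] over the sphere one dimension lower, both
    halves of which are already triangulated. *)
Fixpoint hemi d : seq (seq V) :=
  if d is d'.+1 then map (cons (e d)) (hemi d' ++ map (map -%R) (hemi d'))
  else [:: [:: e 0]].

Let sym d := hemi d ++ map (map -%R) (hemi d).

Let ev_bd_cone f d : ev (fun s => ev f (bd s)) (hemi d.+1) =
  ev f (sym d) (+) ev (fun s => ev (fun u => f (e d.+1 :: u)) (bd s)) (sym d).
Proof.
rewrite /= ev_map -ev_addb; apply: eq_ev => s /=; by rewrite ev_cons ev_map.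
Qed.

Let ev_bdN f c : ev (fun s => ev f (bd s)) (map (map (@GRing.opp V)) c) =
  ev (fun s => ev (fun u => f (map -%R u)) (bd s)) c.
Proof. by rewrite ev_map; apply: eq_ev => s; rewrite bd_map ev_map. Qed.

Let ev_bd_sym f d : ev (fun s => ev f (bd s)) (sym d) = false.
Proof.
elim: d f => [|d IH] f.
  by rewrite /sym /= !ev_cons /= ?ev_cons !ev_nil ?addbF addbb.
rewrite /sym ev_cat ev_bdN !ev_bd_cone !IH !addbF /sym !ev_cat !ev_map.
have -> : ev (fun u => f (map -%R (map -%R u))) (hemi d) = ev f (hemi d).
  apply: eq_ev => s; congr f; rewrite -map_comp -[RHS]map_id.
  by apply: eq_map => x /=; rewrite opprK.
by rewrite [X in _ (+) X]addbC addbb.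
Qed.

Lemma antipodal_chains_hemi : antipodal_chains m hemi.
Proof.
split=> [|d s _|d f _]; first by exists (e 0).
  elim: d s => [|d IH] s; first by rewrite inE => /eqP ->.
  move=> /mapP[u]; rewrite mem_cat => /orP[/IH us|/mapP[w /IH ws ->]] -> /=.
    by rewrite us.
  by rewrite size_map ws.
by rewrite ev_bd_cone ev_bd_sym addbF /sym ev_cat ev_map.
Qed.

Let e_coord d (i : 'I_m.+1) : (d <= m)%N -> e d ord0 i = (i == d :> nat)%:R.
Proof. by move=> dm; rewrite mxE eqxx /= -val_eqE /= inordK. Qed.

(** A face of the cross-polytope lies on a hyperplane missing the origin. Subdivision stays on that
    hyperplane, so subdivided vertices remain bounded away from 0. *)
Lemma hemi_sign d s : (d <= m)%N -> s \in hemi d ->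
  exists y : V, [/\ forall i, y ord0 i ^+ 2 <= 1, {in s, forall x, inner x y = 1} &
    {in s, forall (x : V) i, `|x ord0 i| <= 1}].
Proof.
have le1 (b : bool) : `|b%:R| <= 1 :> R by rewrite normr_nat lern1 leq_b1.
(* The added clause makes the vertices vanish beyond coordinate [d], so coordinate [d.+1] of [y] can
   be reset to 1 for the new apex without changing the old products. *)
pose P d (s : seq V) := exists y : V, [/\ forall i, y ord0 i ^+ 2 <= 1,
  {in s, forall x, inner x y = 1},
  {in s, forall (x : V) i, `|x ord0 i| <= 1} &
  {in s, forall (x : V) (i : 'I_m.+1), (d < i)%N -> x ord0 i = 0}].
suff H : (d <= m)%N -> s \in hemi d -> P d s.
  by move=> dm sd; have [y [? ? ? _]] := H dm sd; exists y.
have inner_e k (y : V) : (k <= m)%N -> inner (e k) y = y ord0 (inord k).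
  move=> km; rewrite /inner (bigD1 (inord k))//= big1 ?addr0 => [|i ik].
    by rewrite e_coord// inordK// eqxx mul1r.
  rewrite e_coord//; case: eqP => [ek|_]; last by rewrite mul0r.
  by case/eqP: ik; apply: val_inj; rewrite /= inordK.
elim: d s => [|d IH] s dm.
  rewrite inE => /eqP ->; exists (e 0); split=> [i|x|x|x].
  - by rewrite e_coord//; case: (_ == _); rewrite ?expr1n// expr0n.
  - by rewrite inE => /eqP ->; rewrite inner_e// e_coord// inordK.
  - by rewrite inE => /eqP -> i; rewrite e_coord.
  - by rewrite inE => /eqP -> i; rewrite e_coord//; case: (nat_of_ord i).
move=> /mapP[u us ->].
have {us} [y [y1 yx x1 y0]] : P d u.
  move: us; rewrite mem_cat => /orP[/IH -/(_ (ltnW dm))//|/mapP[w /IH -/(_ (ltnW dm))]].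
  move=> [y [y1 yx x1 y0]] ->; exists (- y); split=> [i|_ /mapP[x xw ->]|_ /mapP[x xw ->] i|_ /mapP[x xw ->] i id].
  - by rewrite mxE sqrrN.
  - by rewrite -(scaleN1r x) -(scaleN1r y) innerZl innerZr yx// mulr1 mulN1r opprK.
  - by rewrite mxE normrN x1.
  - by rewrite mxE y0// oppr0.
exists (\row_i if i == d.+1 :> nat then 1 else y ord0 i); split=> [i|x|x|x].
- by rewrite mxE; case: ifP => // _; rewrite expr1n.
- rewrite inE => /predU1P[->|xu]; first by rewrite inner_e// mxE inordK// eqxx.
  rewrite -(yx x xu); apply: eq_bigr => i _; rewrite mxE; case: eqP => // id.
  by rewrite y0// ?mul0r// id.
- rewrite inE => /predU1P[->|xu] i; last exact: x1.
  by rewrite e_coord.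
rewrite inE => /predU1P[->|xu] i id; last by rewrite y0// ltnW.
by rewrite e_coord//; case: eqP id => // ->; rewrite ltnn.
Qed.

End CrossPolytope.

(** * Distortion of maps between spheres of consecutive dimensions *)

Section Acos.
Variable R : realType.
Implicit Types X t : R.

Lemma acos_itv X : -1 <= X <= 1 -> 0 <= acos X <= pi.
Proof. by move=> /acos_def[]. Qed.

Lemma acos_le X t : -1 <= X <= 1 -> 0 <= t -> cos t <= X \/ pi <= t ->
  acos X <= t.
Proof.
move=> X1 t0; have /andP[a0 api] := acos_itv X1.
move=> [tX|]; last exact: le_trans.
have [tpi|/ltW] := leP t pi; last exact: le_trans.
rewrite leNgt -ltr_cos ?in_itv/= ?a0 ?t0// acosK ?in_itv//.
by rewrite -leNgt.
Qed.

Lemma le_acos X t : -1 <= X <= 1 -> t <= pi -> X <= cos t \/ t <= 0 ->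
  t <= acos X.
Proof.
move=> X1 tpi; have /andP[a0 api] := acos_itv X1.
move=> [tX|/le_trans->//].
have [t0|/ltW/le_trans->//] := leP 0 t.
rewrite leNgt -ltr_cos ?in_itv/= ?a0 ?t0// acosK ?in_itv//.
by rewrite -leNgt.
Qed.

Lemma cos_le_acos X t : -1 <= X <= 1 -> acos X <= t -> t <= pi -> cos t <= X.
Proof.
move=> X1 aX tpi; have /andP[a0 api] := acos_itv X1.
have t0 := le_trans a0 aX.
rewrite -[leRHS](acosK (x := X)) ?in_itv// leNgt ltr_cos ?in_itv/= ?a0 ?t0//.
by rewrite -leNgt.
Qed.

End Acos.

(** * Radial projection and an odd choice of sign *)

Section Normalize.
Variables (R : realType) (k : nat).
Notation V := 'rV[R]_k.+1.
Implicit Types x y : V.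

Lemma inner_sqr_sum x : inner x x = \sum_(i < k.+1) x ord0 i ^+ 2.
Proof. by apply: eq_bigr => i _; rewrite expr2. Qed.

Lemma pole_subproof : \sum_(i < k.+1) (delta_mx ord0 ord0 : V) ord0 i ^+ 2 == 1.
Proof.
rewrite big_ord_recl big1 => [|i _]; first by rewrite mxE addr0 expr1n.
by rewrite mxE /= expr0n.
Qed.

Definition pole : sphere R k := Sphere pole_subproof.

Definition len x := Num.sqrt (inner x x).

(** The zero vector gets the default value [pole]. *)
Definition normalize x : sphere R k := insubd pole ((len x)^-1 *: x).

Lemma len_gt0 x : 0 < inner x x -> 0 < len x.
Proof. by rewrite sqrtr_gt0. Qed.

Lemma sqr_len x : len x ^+ 2 = inner x x.
Proof. by rewrite sqr_sqrtr// inner_ge0. Qed.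

Lemma normalizeE x : 0 < inner x x -> normalize x = (len x)^-1 *: x :> V.
Proof.
move=> x0; rewrite val_insubd ifT// -inner_sqr_sum innerZl innerZr -sqr_len.
by rewrite expr2 mulrA mulrACA mulrA mulVf ?mul1r ?mulVf// lt0r_neq0// len_gt0.
Qed.

Lemma inner_normalize x y : 0 < inner x x -> 0 < inner y y ->
  inner (normalize x) (normalize y) = inner x y / (len x * len y).
Proof.
move=> x0 y0; rewrite !normalizeE// innerZl innerZr invfM.
by rewrite [RHS]mulrC mulrA [_^-1 * _]mulrC.
Qed.

Lemma lenZ a x : a ^+ 2 = 1 -> len (a *: x) = len x.
Proof. by move=> a1; rewrite /len innerZl innerZr mulrA -expr2 a1 mul1r. Qed.

(** The sign of the first nonzero coordinate. Being odd and of square 1 off the origin, it selects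
    one point of each antipodal pair. *)
Definition first_sign x : R :=
  foldr (fun i a => if x ord0 i == 0 then a else Num.sg (x ord0 i)) 0
    (enum 'I_k.+1).

Lemma first_signN x : first_sign (- x) = - first_sign x.
Proof.
rewrite /first_sign; elim: (enum _) => [|i s IH] /=; first by rewrite oppr0.
by rewrite mxE oppr_eq0; case: ifP => //; rewrite sgrN.
Qed.

Lemma sqr_first_sign x : 0 < inner x x -> first_sign x ^+ 2 = 1.
Proof.
move=> x0; have {x0} : exists i, x ord0 i != 0.
  apply/existsP; rewrite -negb_forall; apply/negP => /forallP x00.
  move: x0; rewrite /inner big1 ?ltxx// => i _.
  by rewrite (eqP (x00 i)) mul0r.
move=> [i xi]; rewrite /first_sign; have := mem_enum 'I_k.+1 i.
rewrite inE; elim: (enum _) => //= j s IH.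
rewrite inE => h; have [xj|xj] := eqVneq (x ord0 j) 0.
  by apply: IH; case/predU1P: h => // ij; rewrite ij xj eqxx in xi.
by rewrite sqr_sg xj.
Qed.

End Normalize.

Section OddExtension.
Variables (R : realType) (k l : nat) (psi : sphere R k -> sphere R l) (d : R).
Hypothesis psi_d : forall u v, `|mdist (psi u) (psi v) - mdist u v| <= d.

(* The helmet trick of Lim, Memoli and Smith: an odd map agreeing up to sign
   with [psi] on a half sphere has the same distortion. *)
Definition odd_ext (x : 'rV[R]_k.+1) : 'rV[R]_l.+1 :=
  first_sign x *: sphere_val (psi (normalize (first_sign x *: x))).

Lemma odd_extN x : odd_ext (- x) = - odd_ext x.
Proof.
by rewrite /odd_ext first_signN scaleNr scalerN scaleNr opprK.
Qed.

Lemma odd_ext_unit x : 0 < inner x x -> inner (odd_ext x) (odd_ext x) = 1.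
Proof.
move=> x0; rewrite /odd_ext innerZl innerZr mulrA -expr2 inner_sphere mulr1.
exact: sqr_first_sign.
Qed.

Lemma inner_odd_ext x y t : 0 < inner x x -> 0 < inner y y ->
  0 <= t -> t + d <= pi ->
  cos t <= inner x y / (len x * len y) ->
  cos (t + d) <= inner (odd_ext x) (odd_ext y).
Proof.
move=> x0 y0 t0 tdpi txy.
have d0 : 0 <= d by apply: le_trans (psi_d (pole R k) (pole R k)); exact: normr_ge0.
rewrite /odd_ext; set a := first_sign x; set b := first_sign y.
have a1 : a ^+ 2 = 1 by exact: sqr_first_sign.
have b1 : b ^+ 2 = 1 by exact: sqr_first_sign.
set u := normalize (a *: x); set v := normalize (b *: y).
have ax0 : 0 < inner (a *: x) (a *: x) by rewrite innerZl innerZr mulrA -expr2 a1 mul1r.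
have by0 : 0 < inner (b *: y) (b *: y) by rewrite innerZl innerZr mulrA -expr2 b1 mul1r.
have uv : inner u v = (a * b) * (inner x y / (len x * len y)).
  by rewrite inner_normalize// !lenZ// innerZl innerZr !mulrA.
rewrite innerZl innerZr mulrA.
have := psi_d u v; rewrite !mdist_sphereE ler_distl => /andP[lo hi].
have iuv := inner_sphere_itv u v; have ipuv := inner_sphere_itv (psi u) (psi v).
have ab : a * b = 1 \/ a * b = -1.
  have : (a * b) ^+ 2 == 1 ^+ 2 by rewrite exprMn a1 b1 mulr1 expr1n.
  by rewrite eqf_sqr => /orP[] /eqP; [left|right].
move: uv; case: ab => ->; rewrite ?mul1r ?mulN1r => uv.
  apply: cos_le_acos => //; apply: le_trans hi _; rewrite lerD2r uv.
  by apply: acos_le => //; [rewrite -uv|left].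
(* With opposite signs, [u] and [v] are at distance at least [pi - t], hence their images at least
   [pi - t - d]; negating one image gives at most [t + d]. *)
apply: cos_le_acos => //; first by rewrite lerNl opprK lerNl andbC.
have : pi - t <= acos (inner u v).
  apply: le_acos => //; first by rewrite lerBlDr lerDl.
  by left; rewrite cosB cospi sinpi uv; lra.
by rewrite acosN//; lra.
Qed.

End OddExtension.

(** * Labelling by the largest coordinate *)

Section CoordinateLabel.
Variables (R : realType) (k : nat).
Implicit Types x y : 'rV[R]_k.+1.

Definition max_coord x : 'I_k.+1 := [arg max_(i > ord0) `|x ord0 i|]%O.

Definition label x : nat * bool := (nat_of_ord (max_coord x), 0 < x ord0 (max_coord x)).

Lemma max_coordP x i : `|x ord0 i| <= `|x ord0 (max_coord x)|.
Proof. by rewrite /max_coord; case: arg_maxP => // j _; apply. Qed.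

Lemma max_coordN x : max_coord (- x) = max_coord x.
Proof.
rewrite /max_coord; congr (Order.arg_max _ _ _).
by apply/funext => i; rewrite mxE normrN.
Qed.

Lemma labelN x : 0 < `|x ord0 (max_coord x)| ->
  label (- x) = ((label x).1, ~~ (label x).2).
Proof.
by move=> x0; rewrite /label max_coordN mxE oppr_gt0 /= lt_neqAle -normr_gt0 x0 -leNgt.
Qed.

Lemma label_close x y r : r < `|x ord0 (max_coord x)| ->
  (forall i, `|x ord0 i - y ord0 i| <= r) ->
  (label x).1 = (label y).1 -> (label x).2 = (label y).2.
Proof.
move=> rx xyr /= /val_inj xy; have := xyr (max_coord x); rewrite -xy.
move: rx; set a := x _ _; set b := y _ _ => ra ab.
apply/idP/idP => h; rewrite ltNge; apply/negP => h'; move: ra ab.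
  by rewrite !ger0_norm ?(ltW h)//; lra.
by rewrite ler0_norm// distrC ger0_norm; lra.
Qed.

End CoordinateLabel.

Lemma sqr_sum_le (R : realType) k (x : 'rV[R]_k) r :
  (forall i, x ord0 i ^+ 2 <= r) -> inner x x <= k%:R * r.
Proof.
move=> xr; rewrite /inner mulr_natl -[X in _ *+ X]card_ord -sumr_const.
by apply: ler_sum => i _; rewrite -expr2.
Qed.

Lemma inner_coord_le (R : realType) k (x y : 'rV[R]_k) a b :
  (forall i, `|x ord0 i| <= a) -> (forall i, `|y ord0 i| <= b) ->
  inner x y <= k%:R * (a * b).
Proof.
move=> xa yb; rewrite /inner mulr_natl -[X in _ *+ X]card_ord -sumr_const.
apply: ler_sum => i _; apply: le_trans (ler_norm _) _; rewrite normrM.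
by rewrite ler_pM.
Qed.

(** This is Cauchy-Schwarz, as the squared length of [y] is at most k+1. *)
Lemma hyperplane_far (R : realType) k (x y : 'rV[R]_k.+1) :
  (forall i, y ord0 i ^+ 2 <= 1) -> inner x y = 1 ->
  k.+1%:R^-1 <= inner x x.
Proof.
move=> y1 xy; have := sqr_sum_le y1; rewrite mulr1 => yy.
have n0 : 0 < k.+1%:R :> R by rewrite ltr0n.
have := inner_ge0 (k.+1%:R *: x - y).
rewrite -[- y]scaleN1r !(innerDl, innerDr, innerZl, innerZr) (innerC y) xy => h.
rewrite -div1r ler_pdivrMr// mulrC -(ler_pM2l n0).
lra.
Qed.

(** The squared length of [x - y] is at least twice [len x * len y] times one minus the cosine, and
    [len x * len y] is at least 1/(k+1). *)
Lemma cos_close (R : realType) k (x y : 'rV[R]_k.+1) r :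
  k.+1%:R^-1 <= inner x x -> k.+1%:R^-1 <= inner y y ->
  (forall i, `|x ord0 i - y ord0 i| <= r) ->
  1 - (k.+1%:R * r) ^+ 2 <= inner x y / (len x * len y).
Proof.
move=> xx yy xyr; have n0 : 0 < k.+1%:R :> R by rewrite ltr0n.
have nV : 0 < k.+1%:R^-1 :> R by rewrite invr_gt0.
have lx := len_gt0 (lt_le_trans nV xx); have ly := len_gt0 (lt_le_trans nV yy).
have lxy : 1 <= k.+1%:R * (len x * len y).
  rewrite -ler_pdivrMl// mulr1.
  rewrite -(ler_pXn2r (n := 2))// ?nnegrE ?mulr_ge0 ?(ltW nV) ?(ltW lx) ?(ltW ly)//.
  by rewrite exprMn !sqr_len expr2 ler_pM// ltW.
rewrite ler_pdivlMr ?mulr_gt0//.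
have : inner (x - y) (x - y) <= k.+1%:R * r ^+ 2.
  apply: sqr_sum_le => i; rewrite -(real_normK (num_real _)).
  have r0 : 0 <= r by apply: le_trans (xyr ord0).
  by rewrite ler_pXn2r ?nnegrE// !mxE xyr.
rewrite -[- y]scaleN1r !(innerDl, innerDr, innerZl, innerZr) (innerC y) -!sqr_len.
have := sqr_ge0 (len x - len y).
have : k.+1%:R * r ^+ 2 * 1 <= k.+1%:R * r ^+ 2 * (k.+1%:R * (len x * len y)).
  by rewrite ler_wpM2l// mulr_ge0 ?sqr_ge0// (ltW n0).
move: (k.+1%:R : R) n0 => N n0; set a := len x; set b := len y => h1 h2 h3.
have := mulr_ge0 (ltW n0) (sqr_ge0 r).
nra.
Qed.

Theorem sphere_distortion_ge (R : realType) n
    (psi : sphere R n.+1 -> sphere R n) (d : R) :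
  (forall u v, `|mdist (psi u) (psi v) - mdist u v| <= d) ->
  acos (- n.+1%:R^-1) <= d.
Proof.
move=> psi_d; rewrite leNgt; apply/negP => dz; pose z : R := acos (- n.+1%:R^-1).
have d0 : 0 <= d.
  by apply: le_trans (psi_d (pole R n.+1) (pole R n.+1)); exact: normr_ge0.
have n0 : 0 < n.+1%:R^-1 :> R by rewrite invr_gt0 ltr0n.
have n1 : n.+1%:R^-1 <= 1 :> R by rewrite invf_le1 ?ltr0n// ler1n.
have zitv : -1 <= - (n.+1%:R^-1 : R) <= 1.
  by rewrite lerN2 n1 (le_trans _ ler01)// oppr_le0 ltW.
have /andP[_ zpi] := acos_itv zitv.
(* With [t] half the gap, points at angle at most [t] have images at angle at most [t + d < z]. *)
pose t := (z - d) / 2; have t0 : 0 < t by rewrite divr_gt0// subr_gt0.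
have tdz : t + d < z by rewrite /t /z in dz *; lra.
have cost : cos t < 1.
  rewrite -cos0 ltr_cos// ?in_itv/= ?lexx ?pi_ge0// (ltW t0) /=.
  by apply: le_trans zpi; rewrite -/z; lra.
have ctd : - n.+1%:R^-1 < cos (t + d).
  rewrite -[ltLHS](acosK (x := - n.+1%:R^-1)) ?in_itv// ltr_cos ?in_itv/=//.
    by rewrite addr_ge0 ?(ltW t0)//=; apply: le_trans (ltW tdz) zpi.
  exact: acos_itv.
(* The cap keeps [h - n.+1%:R^-1] nonpositive, so that below the simplex with most vertices is the
   worst case. *)
pose h := Num.min (cos (t + d) + n.+1%:R^-1) n.+1%:R^-1.
have h0 : 0 < h by rewrite lt_min n0 andbT -ltrBlDr sub0r.
have hn : h <= n.+1%:R^-1 by rewrite ge_min lexx orbT.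
have hcos : h - n.+1%:R^-1 <= cos (t + d) by rewrite lerBlDr ge_min lexx.
(* [cos_close] squares the mesh times n+2; the minimum with 1 makes this square at most
   [1 - cos t]. *)
have [c1 [c1P c1_close c1_hull]] : exists c', [/\ antipodal_chains n.+1 c',
    forall d s, (d <= n.+1)%N -> s \in c' d ->
      close (Num.min 1 (1 - cos t) / n.+2%:R) s &
    forall d s', (d <= n.+1)%N -> s' \in c' d ->
      exists2 s, s \in hemi R n.+1 d &
      forall K, bary_closed K -> {in s, forall v, K v} -> {in s', forall v, K v}].
  apply: (subdivide (r := 2)) (antipodal_chains_hemi R n.+1) _ _.
    move=> k s kn sk x y xs ys i.
    have [_ [_ _ s1]] := hemi_sign kn sk.
    by apply: le_trans (ler_normB _ _) _; rewrite -[2]/(1 + 1) lerD// s1.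
  by rewrite divr_gt0// lt_min ltr01 subr_gt0.
pose f := odd_ext psi; pose c2 k := map (map f) (c1 k).
have far k s x : (k <= n.+1)%N -> s \in c1 k -> x \in s -> n.+2%:R^-1 <= inner x x.
  move=> kn sc xs; have [s0 s0h s0K] := c1_hull k s kn sc.
  have [y [y1 yx _]] := hemi_sign kn s0h.
  apply: (hyperplane_far y1).
  by have := s0K _ (@bary_closed_hyperplane _ _ y 1) yx x xs.
have N0 : 0 < n.+2%:R :> R by rewrite ltr0n.
have far0 k s x : (k <= n.+1)%N -> s \in c1 k -> x \in s -> 0 < inner x x.
  move=> kn sc xs; apply: lt_le_trans (far k s x kn sc xs).
  by rewrite invr_gt0.
have c2_unit k s w : (k <= n.+1)%N -> s \in c2 k -> w \in s -> inner w w = 1.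
  move=> kn /mapP[u uc ->] /mapP[x xu ->].
  by rewrite odd_ext_unit//; exact: far0 kn uc xu.
have c2_inner k s : (k <= n.+1)%N -> s \in c2 k ->
    {in s &, forall w w', h - n.+1%:R^-1 <= inner w w'}.
  move=> kn /mapP[u uc ->] _ _ /mapP[x xu ->] /mapP[y yu ->].
  apply: le_trans hcos _; apply: (inner_odd_ext psi_d).
  - exact: far0 kn uc xu.
  - exact: far0 kn uc yu.
  - exact: ltW.
  - exact: le_trans (ltW tdz) zpi.
  apply: le_trans (cos_close (far _ _ _ kn uc xu) (far _ _ _ kn uc yu)
    (c1_close _ _ kn uc _ _ xu yu)).
  rewrite mulrC divfK ?lt0r_neq0//.
  set q := Num.min _ _; have q0 : 0 <= q by rewrite le_min ler01 subr_ge0 ltW.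
  have q1 : q <= 1 by rewrite ge_min lexx.
  have qt : q <= 1 - cos t by rewrite ge_min lexx orbT.
  by rewrite lerBrDl -lerBrDr; apply: le_trans qt; rewrite expr2 ler_piMr.
(* Half the lower bound on the largest coordinate that is proved in [c3_far]. *)
pose r := h / (n.+1%:R * n.+2%:R) / 2.
have r0 : 0 < r by rewrite !divr_gt0// mulr_gt0// ltr0n.
have [c3 [c3P c3_close c3_hull]] : exists c', [/\ antipodal_chains n.+1 c',
    forall d s, (d <= n.+1)%N -> s \in c' d -> close r s &
    forall d s', (d <= n.+1)%N -> s' \in c' d ->
      exists2 s, s \in c2 d &
      forall K, bary_closed K -> {in s, forall v, K v} -> {in s', forall v, K v}].
  apply: (subdivide (r := 2)) => //.
    by apply: antipodal_chains_map c1P => v; exact: odd_extN.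
  move=> k s kn sk x y xs ys i.
  have le1 w : w \in s -> `|w ord0 i| <= 1.
    move=> ws; rewrite -(ler_pXn2r (n := 2))// ?nnegrE// expr1n (real_normK (num_real _)).
    rewrite -(c2_unit k s w kn sk ws) inner_sqr_sum (bigD1 i)//= lerDl.
    by apply: sumr_ge0 => j _; exact: sqr_ge0.
  by apply: le_trans (ler_normB _ _) _; rewrite -[2]/(1 + 1) lerD// le1.
have c3_far k s x : (k <= n.+1)%N -> s \in c3 k -> x \in s ->
    r < `|x ord0 (max_coord x)|.
  move=> kn sc xs; have [s0 s0c s0K] := c3_hull k s kn sc.
  (* The vertices of [s0] lie in an open half-space around their sum: the product of one with [M] is
     at least 1 + k(h - 1/(n+1)), which is at least [h] as k is at most n+1. *)
  pose M := \sum_(w <- s0) w.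
  have size_s0 : size s0 = k.+1.
    by have [_ sz _] := antipodal_chains_map (odd_extN psi) c1P; exact: sz kn s0c.
  have Mh : {in s0, forall w, h <= inner w M}.
    move=> w ws.
    have -> : inner w M = \sum_(w' <- s0) inner w w'.
      rewrite /M; elim: (s0) => [|v v' IH]; first by rewrite !big_nil innerC inner0l.
      by rewrite !big_cons innerDr IH.
    rewrite (big_rem w)//= (c2_unit k s0 w kn s0c ws).
    apply: le_trans (_ : 1 + (h - n.+1%:R^-1) *+ size (rem w s0) <= _).
      rewrite size_rem// size_s0 /=.
      have : (h - n.+1%:R^-1) *+ n.+1 <= (h - n.+1%:R^-1) *+ k.
        by rewrite -[X in _ *+ X <= _](subnKC kn) mulrnDr gerDl mulrn_wle0// subr_le0.
      rewrite mulrnBl -[n.+1%:R^-1 *+ _]mulr_natr mulVf ?pnatr_eq0//.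
      have : h <= h *+ n.+1 by rewrite mulrS lerDl mulrn_wge0// ltW.
      by move: (_ *+ k) (h *+ _) => a b; lra.
    rewrite lerD2l.
    have {s0K} : {in rem w s0, forall w', h - n.+1%:R^-1 <= inner w w'}.
      by move=> w' /mem_rem w's; exact: c2_inner kn s0c _ _ ws w's.
    elim: (rem w s0) => [|v v' IH] vi; first by rewrite big_nil.
    rewrite big_cons mulrS lerD ?vi ?mem_head// IH// => y yv.
    by rewrite vi// inE yv orbT.
  have hx : h <= inner x M by have := s0K _ (@bary_closed_halfspace _ _ M h) Mh x xs.
  have M1 i : `|M ord0 i| <= n.+2%:R.
    apply: le_trans (_ : k.+1%:R <= _); last by rewrite ler_nat ltnS.
    rewrite /M summxE -size_s0; apply: le_trans (ler_norm_sum _ _ _) _.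
    have : {in s0, forall w : 'rV[R]_n.+1, `|w ord0 i| <= 1}.
      move=> w ws; rewrite -(ler_pXn2r (n := 2))// ?nnegrE// expr1n (real_normK (num_real _)).
      rewrite -(c2_unit k s0 w kn s0c ws) inner_sqr_sum (bigD1 i)//= lerDl.
      by apply: sumr_ge0 => j _; exact: sqr_ge0.
    elim: (s0) => [|v v' IH] v1; first by rewrite big_nil.
    rewrite big_cons /= -natr1 addrC lerD ?v1 ?mem_head// IH// => y yv.
    by rewrite v1// inE yv orbT.
  (* Since [M] has coordinates at most n+2, a product of at least [h] with [M] forces a large
     coordinate of [x]. *)
  have := inner_coord_le (max_coordP x) M1; set b := `|_|.
  rewrite mulrCA [b * _]mulrC => hb; rewrite /r ltr_pdivrMr// ltr_pdivrMr ?mulr_gt0 ?ltr0n//.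
  have b0 : 0 < b.
    rewrite normr_gt0; apply/eqP => bE; move: hb; rewrite /b bE normr0 !mulr0.
    by move=> /(le_trans hx); rewrite leNgt h0.
  have : 0 < b * (n.+1%:R * n.+2%:R) by rewrite !mulr_gt0// ltr0n.
  lra.
apply: (antipodal_chains_complementary (lab := @label R n) c3P).
- move=> k s v kn sc vs; apply: labelN.
  exact: lt_trans r0 (c3_far k s v kn sc vs).
- by move=> s v _ _; exact: ltn_ord.
- move=> s u v sc us vs; apply: label_close (c3_far _ _ _ (leqnn _) sc us) _.
  exact: c3_close sc u v us vs.
Qed.

(** * The regular simplex and its cells *)

Section CellInequalities.
Variable R : realFieldType.

Lemma ord5P (P : 'I_5 -> Prop) :
  P (inord 0) -> P (inord 1) -> P (inord 2) -> P (inord 3) -> P (inord 4) ->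
  forall i, P i.
Proof.
move=> p0 p1 p2 p3 p4 i; rewrite -(inord_val i).
by case: i => [[|[|[|[|[|i]]]]] hi].
Qed.

Lemma sum5E (F : 'I_5 -> R) :
  \sum_i F i = F (inord 0) + F (inord 1) + F (inord 2) + F (inord 3) + F (inord 4).
Proof.
rewrite !big_ord_recl big_ord0 addr0 !addrA.
by congr (F _ + F _ + F _ + F _ + F _); apply: val_inj; rewrite /= inordK.
Qed.

Lemma sum5_perm (s : {perm 'I_5}) (F : 'I_5 -> R) :
  \sum_i F i = F (s (inord 0)) + F (s (inord 1)) + F (s (inord 2)) +
    F (s (inord 3)) + F (s (inord 4)).
Proof. by rewrite (reindex_inj (@perm_inj _ s)) sum5E. Qed.

(** Let a_i and b_i be the gaps below the maxima, with sums A and B. The form is the sum of (a_i +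
    b_i)^2 + a_i b_i, minus ((A+B)^2 + AB)/5. Cauchy-Schwarz bounds the sum below by (A+B)^2/4, and
    AB is at most (A+B)^2/4. *)
Let quad_max (x0 x1 x2 x3 x4 y0 y1 y2 y3 y4 : R) :
  x0 + x1 + x2 + x3 + x4 = 0 -> y0 + y1 + y2 + y3 + y4 = 0 ->
  x1 <= x0 -> x2 <= x0 -> x3 <= x0 -> x4 <= x0 ->
  y1 <= y0 -> y2 <= y0 -> y3 <= y0 -> y4 <= y0 ->
  0 <= x0^+2 + x1^+2 + x2^+2 + x3^+2 + x4^+2 +
    (y0^+2 + y1^+2 + y2^+2 + y3^+2 + y4^+2) +
    3 * (x0 * y0 + x1 * y1 + x2 * y2 + x3 * y3 + x4 * y4).
Proof.
move=> sx sy h1 h2 h3 h4 k1 k2 k3 k4.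
pose a1 := x0 - x1; pose a2 := x0 - x2; pose a3 := x0 - x3; pose a4 := x0 - x4.
pose b1 := y0 - y1; pose b2 := y0 - y2; pose b3 := y0 - y3; pose b4 := y0 - y4.
have Ex0 : x0 = (a1 + a2 + a3 + a4) / 5 by rewrite /a1 /a2 /a3 /a4; lra.
have Ey0 : y0 = (b1 + b2 + b3 + b4) / 5 by rewrite /b1 /b2 /b3 /b4; lra.
have Ex1 : x1 = x0 - a1 by rewrite /a1; ring.
have Ex2 : x2 = x0 - a2 by rewrite /a2; ring.
have Ex3 : x3 = x0 - a3 by rewrite /a3; ring.
have Ex4 : x4 = x0 - a4 by rewrite /a4; ring.
have Ey1 : y1 = y0 - b1 by rewrite /b1; ring.
have Ey2 : y2 = y0 - b2 by rewrite /b2; ring.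
have Ey3 : y3 = y0 - b3 by rewrite /b3; ring.
have Ey4 : y4 = y0 - b4 by rewrite /b4; ring.
have p1 : 0 <= a1 * b1 by rewrite mulr_ge0// subr_ge0.
have p2 : 0 <= a2 * b2 by rewrite mulr_ge0// subr_ge0.
have p3 : 0 <= a3 * b3 by rewrite mulr_ge0// subr_ge0.
have p4 : 0 <= a4 * b4 by rewrite mulr_ge0// subr_ge0.
rewrite Ex1 Ex2 Ex3 Ex4 Ey1 Ey2 Ey3 Ey4 Ex0 Ey0.
move: a1 a2 a3 a4 b1 b2 b3 b4 p1 p2 p3 p4 {Ex0 Ey0 Ex1 Ex2 Ex3 Ex4 Ey1 Ey2 Ey3 Ey4}.
move=> a1 a2 a3 a4 b1 b2 b3 b4 p1 p2 p3 p4.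
have s1 := sqr_ge0 (a1 + a2 + a3 + a4 - (b1 + b2 + b3 + b4)).
have s12 := sqr_ge0 (a1 + b1 - (a2 + b2)).
have s13 := sqr_ge0 (a1 + b1 - (a3 + b3)).
have s14 := sqr_ge0 (a1 + b1 - (a4 + b4)).
have s23 := sqr_ge0 (a2 + b2 - (a3 + b3)).
have s24 := sqr_ge0 (a2 + b2 - (a4 + b4)).
have s34 := sqr_ge0 (a3 + b3 - (a4 + b4)).
lra.
Qed.

Let quad_max_min (x0 x1 x2 x3 x4 y0 y1 y2 y3 y4 : R) :
  x0 + x1 + x2 + x3 + x4 = 0 -> y0 + y1 + y2 + y3 + y4 = 0 ->
  x1 <= x0 -> x2 <= x0 -> x3 <= x0 -> x4 <= x1 -> x4 <= x2 -> x4 <= x3 ->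
  y1 <= y0 -> y2 <= y0 -> y3 <= y0 -> y4 <= y1 -> y4 <= y2 -> y4 <= y3 ->
  0 <= x0^+2 + x1^+2 + x2^+2 + x3^+2 + x4^+2 +
    (y0^+2 + y1^+2 + y2^+2 + y3^+2 + y4^+2) +
    8 * (x0 * y0 + x1 * y1 + x2 * y2 + x3 * y3 + x4 * y4).
Proof.
move=> sx sy h1 h2 h3 h4 h5 h6 k1 k2 k3 k4 k5 k6.
(* Centring [x] at its midrange turns the inner product into 2AB plus the sum of a_i y_i over the
   three middle indices, where a_i is at most A in absolute value. *)
pose A := (x0 - x4) / 2; pose B := (y0 - y4) / 2.
pose mx := (x0 + x4) / 2; pose my := (y0 + y4) / 2.
pose a1 := x1 - mx; pose a2 := x2 - mx; pose a3 := x3 - mx.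
pose b1 := y1 - my; pose b2 := y2 - my; pose b3 := y3 - my.
have Ex1 : x1 = mx + a1 by rewrite /a1; ring.
have Ex2 : x2 = mx + a2 by rewrite /a2; ring.
have Ex3 : x3 = mx + a3 by rewrite /a3; ring.
have Ey1 : y1 = my + b1 by rewrite /b1; ring.
have Ey2 : y2 = my + b2 by rewrite /b2; ring.
have Ey3 : y3 = my + b3 by rewrite /b3; ring.
have Ex0 : x0 = mx + A by rewrite /A /mx; field.
have Ex4 : x4 = mx - A by rewrite /A /mx; field.
have Ey0 : y0 = my + B by rewrite /B /my; field.
have Ey4 : y4 = my - B by rewrite /B /my; field.
clearbody A B mx my a1 a2 a3 b1 b2 b3; subst x0 x1 x2 x3 x4 y0 y1 y2 y3 y4.
have Emx : mx = - (a1 + a2 + a3) / 5 by lra.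
have Emy : my = - (b1 + b2 + b3) / 5 by lra.
pose g1 := my + b1; pose g2 := my + b2; pose g3 := my + b3.
(* The constant balances exactly: the form is the squared length of [x + y], at least 2(A+B)^2 and
   so at least 8AB, plus 6 times an inner product of at least (2 - 10/3)AB. *)
have gB : `|g1| + `|g2| + `|g3| <= 10 / 3 * B.
  rewrite /g1 /g2 /g3; have [] := ger0P (my + b1); have [] := ger0P (my + b2);
  have [] := ger0P (my + b3); lra.
have ag a g : `|a| <= A -> - (A * `|g|) <= a * g.
  move=> aA; rewrite lerNl -mulNr; apply: le_trans (ler_norm _) _.
  by rewrite normrM normrN ler_wpM2r.
have ag1 : - (A * `|g1|) <= a1 * g1 by apply: ag; rewrite ler_norml; lra.
have ag2 : - (A * `|g2|) <= a2 * g2 by apply: ag; rewrite ler_norml; lra.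
have ag3 : - (A * `|g3|) <= a3 * g3 by apply: ag; rewrite ler_norml; lra.
have A0 : 0 <= A by lra.
have B0 : 0 <= B by lra.
have AgB := ler_wpM2l A0 gB.
have AB := mulr_ge0 A0 B0.
have sAB := sqr_ge0 (A - B).
have P : - (10 / 3 * (A * B)) <= a1 * g1 + a2 * g2 + a3 * g3 by lra.
move: P; rewrite /g1 /g2 /g3 Emx Emy => P.
have s12 := sqr_ge0 (a1 + b1 - (a2 + b2)).
have s13 := sqr_ge0 (a1 + b1 - (a3 + b3)).
have s23 := sqr_ge0 (a2 + b2 - (a3 + b3)).
have s1 := sqr_ge0 (a1 + b1).
have s2 := sqr_ge0 (a2 + b2).
have s3 := sqr_ge0 (a3 + b3).
clear -AB sAB P s12 s13 s23 s1 s2 s3; lra.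
Qed.

Lemma max_cell_ge (x y : 'I_5 -> R) j :
  \sum_i x i = 0 -> \sum_i y i = 0 ->
  (forall i, x i <= x j) -> (forall i, y i <= y j) ->
  0 <= \sum_i x i ^+ 2 + \sum_i y i ^+ 2 + 3 * \sum_i x i * y i.
Proof.
pose s := tperm (inord 0) j; have s0 : s (inord 0) = j by exact: tpermL.
clearbody s; rewrite !(sum5_perm s) s0 => sx sy xj yj.
exact: quad_max.
Qed.

Lemma max_min_cell_ge (x y : 'I_5 -> R) j k : j != k ->
  \sum_i x i = 0 -> \sum_i y i = 0 ->
  (forall i, x k <= x i <= x j) -> (forall i, y k <= y i <= y j) ->
  0 <= \sum_i x i ^+ 2 + \sum_i y i ^+ 2 + 8 * \sum_i x i * y i.
Proof.
move=> jk; pose s1 := tperm (inord 0) j; pose s2 := tperm (inord 4) (s1 k).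
pose s := (s2 * s1)%g.
have s4 : s (inord 4) = k by rewrite permM tpermL tpermK.
have s0 : s (inord 0) = j.
  rewrite permM [s2 _]tpermD ?tpermL//; first by apply/eqP => /(congr1 val); rewrite /= !inordK.
  apply: contra jk => /eqP e; apply/eqP; rewrite -[k](tpermK (inord 0) j) -/s1 e.
  by rewrite /s1 tpermL.
clearbody s; rewrite !(sum5_perm s) s0 s4 => sx sy xjk yjk.
have xj i : x i <= x j by have /andP[] := xjk i.
have kx i : x k <= x i by have /andP[] := xjk i.
have yj i : y i <= y j by have /andP[] := yjk i.
have ky i : y k <= y i by have /andP[] := yjk i.
exact: quad_max_min.
Qed.

End CellInequalities.

(** * Comparing distances through cosines *)

Section Zeta.
Variable R : realType.
Implicit Types X Y r : R.

Definition zeta3 : R := acos (- (1 / 4)).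

Lemma cos_zeta3 : cos zeta3 = - (1 / 4).
Proof. by rewrite /zeta3 acosK// in_itv/=; lra. Qed.

Lemma zeta3_itv : pi / 2 <= zeta3 <= pi.
Proof.
have h1 : -1 <= - (1 / 4 : R) <= 1 by apply/andP; split; lra.
have /andP[_ ->] := acos_itv h1; rewrite andbT.
apply: le_acos => //; first by have := pi_gt0 R; lra.
by left; rewrite cos_pihalf; lra.
Qed.

(** The number [r] is a lower bound for the product of the sines of [acos Y] and [zeta3], so the
    addition formulas reduce both inequalities to bounds on [X]. The alternatives on [Y] are the
    cases where [acos Y] plus or minus [zeta3] leaves the range of [acos]. *)
Lemma acos_dist_le X Y r : -1 <= X <= 1 -> -1 <= Y <= 1 -> 0 <= r ->
  16 * r ^+ 2 <= 15 * (1 - Y ^+ 2) ->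
  Y <= 1 / 4 \/ - Y / 4 - r <= X -> - (1 / 4) <= Y \/ X <= - Y / 4 + r ->
  `|acos Y - acos X| <= zeta3.
Proof.
move=> X1 Y1 r0 rY lo hi.
have /andP[z2 zpi] := zeta3_itv.
have /andP[a0 api] := acos_itv Y1.
have ca : cos (acos Y) = Y by rewrite acosK// in_itv.
have cz := cos_zeta3.
have pi0 := pi_gt0 R.
have z0 : 0 <= zeta3 by lra.
have sa : 0 <= sin (acos Y) by rewrite sin_ge0_pi// a0.
have sz : 0 <= sin zeta3 by rewrite sin_ge0_pi// z0.
have r_le : r <= sin (acos Y) * sin zeta3.
  rewrite -(ler_pXn2r (n := 2))// ?nnegrE ?mulr_ge0//.
  by rewrite exprMn !sin2cos2 ca cz; lra.
rewrite distrC ler_distl; apply/andP; split.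
  apply: le_acos => //; first by lra.
  case: hi => [hY|hX]; last by left; rewrite cosB ca cz; lra.
  right; rewrite subr_le0; apply: acos_le => //; left.
  by rewrite cz.
apply: acos_le => //; first by rewrite addr_ge0.
case: lo => [hY|hX]; last by left; rewrite cosD ca cz; lra.
right; rewrite -lerBlDr; apply: le_acos => //; first by lra.
by left; rewrite cosB cospi sinpi cz; lra.
Qed.

End Zeta.

(** * A regular simplex inscribed in the 3-sphere *)

Section Simplex.
Variable R : realType.
Notation V := 'rV[R]_4.
Implicit Types v w : V.

Let s5 : R := Num.sqrt 5.

Let s5E : s5 ^+ 2 = 5. Proof. by rewrite sqr_sqrtr. Qed.

Definition simplex (i : 'I_5) : V :=
  \row_c (if (i < 4)%N then (i == c :> nat)%:R * s5 / 2 + (1 - s5) / 8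
          else - (1 / 2)).

Let inner4E v w : inner v w =
  v ord0 (inord 0) * w ord0 (inord 0) + v ord0 (inord 1) * w ord0 (inord 1) +
  v ord0 (inord 2) * w ord0 (inord 2) + v ord0 (inord 3) * w ord0 (inord 3).
Proof.
rewrite /inner !big_ord_recl big_ord0 addr0 !addrA.
congr (v _ _ * w _ _ + v _ _ * w _ _ + v _ _ * w _ _ + v _ _ * w _ _);
  by apply: val_inj; rewrite /= inordK.
Qed.

Lemma inner_simplex i j :
  inner (simplex i) (simplex j) = if i == j then 1 else - (1 / 4).
Proof.
rewrite -val_eqE.
by elim/ord5P: i; elim/ord5P: j; rewrite inner4E !mxE /= !inordK //=;
  have := s5E; lra.
Qed.

Lemma sum_simplex v : \sum_i inner v (simplex i) = 0.
Proof.
by rewrite sum5E !inner4E !mxE !inordK //=; have := s5E; lra.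
Qed.

(** The vertices form a tight frame: up to the factor 5/4, vectors are replaced by zero-sum
    5-tuples, to which the cell inequalities apply. *)
Lemma inner_simplexE v w :
  \sum_i inner v (simplex i) * inner w (simplex i) = 5 / 4 * inner v w.
Proof.
rewrite sum5E !inner4E !mxE !inordK //=.
move: (v ord0 (inord 0)) (v ord0 (inord 1)) (v ord0 (inord 2)) (v ord0 (inord 3)) => v0 v1 v2 v3.
move: (w ord0 (inord 0)) (w ord0 (inord 1)) (w ord0 (inord 2)) (w ord0 (inord 3)) => w0 w1 w2 w3.
have := s5E; move: s5 => s sE.
rewrite [LHS](_ : _ = 5 / 4 * (v0 * w0 + v1 * w1 + v2 * w2 + v3 * w3) +
  (s ^+ 2 - 5) * ((v0 * w0 + v1 * w1 + v2 * w2 + v3 * w3) / 4 -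
    (v0 + v1 + v2 + v3) * (w0 + w1 + w2 + w3) / 16)); last by field.
by rewrite sE subrr mul0r addr0.
Qed.
End Simplex.

Lemma innerNl (R : realType) k (v w : 'rV[R]_k) : inner (- v) w = - inner v w.
Proof. by rewrite -scaleN1r innerZl mulN1r. Qed.

Lemma innerNr (R : realType) k (v w : 'rV[R]_k) : inner v (- w) = - inner v w.
Proof. by rewrite innerC innerNl innerC. Qed.

(** * Cells of the simplex and the values of the correspondence *)

Section Cells.
Variable R : realType.
Notation V := 'rV[R]_4.
Notation p := (simplex R).
Implicit Types v w : V.

Definition cell j v := forall i, inner v (p i) <= inner v (p j).

Definition subcell j k v :=
  forall i, inner v (p k) <= inner v (p i) <= inner v (p j).

Lemma subcell_cell j k v : subcell j k v -> cell j v.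
Proof. by move=> h i; have /andP[] := h i. Qed.

Lemma subcell_opp j k v : subcell j k v -> subcell k j (- v).
Proof. by move=> h i; rewrite !innerNl !lerN2 andbC h. Qed.

(** For unit vectors the cosine is at least -2/3 on a cell; in [subcell_inner] it is at least -1/4,
    the cosine of [zeta3]. *)
Lemma cell_inner j v w : cell j v -> cell j w ->
  0 <= inner v v + inner w w + 3 * inner v w.
Proof.
move=> vj wj; have := max_cell_ge (sum_simplex v) (sum_simplex w) vj wj.
under eq_bigr do rewrite expr2.
under [in X in _ + X + _]eq_bigr do rewrite expr2.
by rewrite !inner_simplexE; lra.
Qed.

Lemma subcell_inner j k v w : j != k -> subcell j k v -> subcell j k w ->
  0 <= inner v v + inner w w + 8 * inner v w.
Proof.
move=> jk vj wj; have := max_min_cell_ge jk (sum_simplex v) (sum_simplex w) vj wj.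
under eq_bigr do rewrite expr2.
under [in X in _ + X + _]eq_bigr do rewrite expr2.
by rewrite !inner_simplexE; lra.
Qed.

Definition tip j k : V := (3 / 4) *: p j - (1 / 2) *: p k.

Lemma inner_tipl j k w : inner (tip j k) w = 3 / 4 * inner (p j) w - 1 / 2 * inner (p k) w.
Proof. by rewrite /tip innerDl innerNl !innerZl. Qed.

Lemma inner_tipr j k w : inner w (tip j k) = 3 / 4 * inner w (p j) - 1 / 2 * inner w (p k).
Proof. by rewrite innerC inner_tipl !(innerC w). Qed.

(* [q] is one of the values of the correspondence at the point [(v, h)] of the
   upper half of the 4-sphere. *)
Variant assigned v (h : R) (q : V) : Prop :=
| Equator of h = 0 & q = v
| Low j k of 0 < h & h <= 1 / 2 & j != k & subcell j k v & q = tip j k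
| High j of 1 / 2 <= h & cell j v & q = p j.

Lemma cell_simplex_ge0 j v : cell j v -> 0 <= inner v (p j).
Proof.
move=> vj; have : \sum_i inner v (p i) <= \sum_(i < 5) inner v (p j).
  by apply: ler_sum.
by rewrite sum_simplex sumr_const card_ord pmulrn_lge0.
Qed.

Lemma subcell_simplex_le0 j k v : subcell j k v -> inner v (p k) <= 0.
Proof.
move=> /subcell_opp/subcell_cell/cell_simplex_ge0.
by rewrite innerNl oppr_ge0.
Qed.

Lemma inner_assigned_ge0 v h q : assigned v h q -> 0 <= inner v q.
Proof.
case=> [_ ->|j k _ _ _ vjk ->|j _ vj ->]; first exact: inner_ge0.
  rewrite inner_tipr; have := cell_simplex_ge0 (subcell_cell vjk).
  by have := subcell_simplex_le0 vjk; lra.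
exact: cell_simplex_ge0.
Qed.

Lemma assigned_unit v h q : inner v v + h ^+ 2 = 1 -> assigned v h q -> inner q q = 1.
Proof.
move=> vh [h0 ->|j k _ _ jk _ ->|j _ _ ->].
- by rewrite -vh h0 expr0n addr0.
- by rewrite inner_tipl !inner_tipr !inner_simplex !eqxx [k == j]eq_sym (negbTE jk); lra.
- by rewrite inner_simplex eqxx.
Qed.

Lemma assigned_exists v h : inner v v + h ^+ 2 = 1 -> 0 <= h -> exists q, assigned v h q.
Proof.
move=> vh h0; pose j := [arg max_(i > ord0 : 'I_5) inner v (p i)]%O.
have vj : cell j v by rewrite /j; case: arg_maxP => // i _ im l; exact: im.
have [h1|/ltW h1] := leP (1 / 2) h; first by exists (p j); apply: High h1 vj _.
move: h0; rewrite le_eqVlt => /predU1P[h0|h0]; first by exists v; exact: Equator.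
pose k0 := lift j ord0 : 'I_5; have k0j : j != k0 by exact: neq_lift.
(* Excluding [j] ensures [j != k] even with ties; the minimum is still global because [j] is a
   maximum. *)
pose k := [arg min_(i < k0 | j != i) inner v (p i)]%O.
have [jk vk] : j != k /\ forall i, j != i -> inner v (p k) <= inner v (p i).
  by rewrite /k; case: arg_minP => // i ji im; split.
exists (tip j k); apply: Low h0 h1 jk _ _ => // i; rewrite vj andbT.
by have [<-|/vk//] := eqVneq j i; exact: vj.
Qed.

Let innerN2 v w : inner (- v) (- w) = inner v w.
Proof. by rewrite innerNl innerNr opprK. Qed.

Let low_low v h j k v' h' j' k' (X := inner v v' + h * h')
    (Y := inner (tip j k) (tip j' k')) :
  inner v v + h ^+ 2 = 1 -> inner v' v' + h' ^+ 2 = 1 ->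
  0 <= h -> h <= 1 / 2 -> j != k -> subcell j k v ->
  0 <= h' -> h' <= 1 / 2 -> j' != k' -> subcell j' k' v' ->
  -1 <= X <= 1 -> -1 <= Y <= 1 -> `|acos Y - acos X| <= zeta3 R.
Proof.
move=> vh vh' h0 h1 jk vjk h0' h1' jk' vjk'.
have hh0 : 0 <= h * h' by rewrite mulr_ge0.
have hh1 : h * h' <= 1 / 4.
  by have := ler_pM h0 h0' h1 h1'; lra.
have hsq := sqr_ge0 h; have hsq' := sqr_ge0 h'.
have -> : Y = 9 / 16 * inner (p j) (p j') - 3 / 8 * inner (p j) (p k') -
    3 / 8 * inner (p k) (p j') + 1 / 4 * inner (p k) (p k').
  by rewrite /Y inner_tipl !inner_tipr; lra.
(* The coincidences among the indices leave six values of [Y]: 1, 11/16, -61/64, -31/64, 19/64 and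
   -1/64. Each [r] below is a rational number at most sqrt(15 (1 - Y^2))/4. *)
rewrite !inner_simplex => X1.
have [jj|jj] := eqVneq j j'.
  move: vjk' jk'; rewrite -jj [k == j]eq_sym (negbTE jk) => vjk' jk'.
  rewrite (negbTE jk'); have [kk|kk] := eqVneq k k' => Y1.
    move: vjk'; rewrite -kk => vjk'.
    apply: (@acos_dist_le _ _ _ 0) => //; first lra.
      by right; have := subcell_inner jk vjk vjk'; rewrite /X; lra.
    by left; lra.
  apply: (@acos_dist_le _ _ _ (45 / 64)) => //; try lra.
    by right; have := cell_inner (subcell_cell vjk) (subcell_cell vjk'); rewrite /X; lra.
have [jk2|jk2] := eqVneq j k'.
  have vj' : subcell j j' (- v') by rewrite jk2; exact: subcell_opp.
  have [kj|kj] := eqVneq k j' => Y1.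
    move: Y1; rewrite -jk2 [k == j]eq_sym (negbTE jk) => Y1.
    apply: (@acos_dist_le _ _ _ (75 / 256)) => //; try lra.
    right; move: vj'; rewrite -kj => /(subcell_inner jk vjk).
    by rewrite innerN2 innerNr /X; lra.
  move: Y1; rewrite -jk2 [k == j]eq_sym (negbTE jk) => Y1.
  apply: (@acos_dist_le _ _ _ (4 / 5)) => //; try lra.
  right; have := cell_inner (subcell_cell vjk) (subcell_cell vj').
  by rewrite innerN2 innerNr /X; lra.
have [kj|kj] := eqVneq k j' => Y1.
  move: Y1; rewrite kj (negbTE jk') => Y1.
  apply: (@acos_dist_le _ _ _ (4 / 5)) => //; try lra.
  right; have := cell_inner (subcell_cell (subcell_opp vjk)) (subcell_cell _ : cell k v').
  move=> /(_ k'); rewrite innerN2 innerNl kj => /(_ vjk').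
  by rewrite /X; lra.
move: Y1; have [kk|kk] := eqVneq k k' => Y1.
  apply: (@acos_dist_le _ _ _ (9 / 10)) => //; try lra.
  right; move: vjk'; rewrite -kk => /subcell_opp/subcell_cell.
  move/(cell_inner (subcell_cell (subcell_opp vjk))).
  by rewrite !innerN2 /X; lra.
by apply: (@acos_dist_le _ _ _ 0) => //; lra.
Qed.

Let low_high v h j k v' h' j' (X := inner v v' + h * h')
    (Y := inner (tip j k) (p j')) :
  inner v v + h ^+ 2 = 1 -> inner v' v' + h' ^+ 2 = 1 ->
  0 <= h -> h <= 1 / 2 -> j != k -> subcell j k v ->
  1 / 2 <= h' -> cell j' v' ->
  -1 <= X <= 1 -> -1 <= Y <= 1 -> `|acos Y - acos X| <= zeta3 R.
Proof.
move=> vh vh' h0 h1 jk vjk h1' vj'.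
have h0' : 0 <= h' by lra.
have hh0 : 0 <= h * h' by rewrite mulr_ge0.
have hh1 : h * h <= 1 / 4.
  by have := ler_pM h0 h0 h1 h1; lra.
(* For fixed [h], the quantity h h' - h'^2/3 in the upper bound on [X] is largest at h' = 3h/2. *)
have hsq := sqr_ge0 h; have hsq' := sqr_ge0 h'; have hsq2 := sqr_ge0 (h' - 3 / 2 * h).
rewrite /Y inner_tipl !inner_simplex => X1.
have [jj|jj] := eqVneq j j'.
  move: vj'; rewrite -jj [k == j]eq_sym (negbTE jk) => vj' Y1.
  apply: (@acos_dist_le _ _ _ (15 / 32)) => //; try lra.
  by right; have := cell_inner (subcell_cell vjk) vj'; rewrite /X; lra.
have [kj|kj] := eqVneq k j' => Y1.
  apply: (@acos_dist_le _ _ _ (45 / 64)) => //; try lra.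
  right; move: vj'; rewrite -kj => /(cell_inner (subcell_cell (subcell_opp vjk))).
  by rewrite innerN2 innerNl /X; lra.
by apply: (@acos_dist_le _ _ _ 0) => //; lra.
Qed.

Let high_high v h j v' h' j' (X := inner v v' + h * h')
    (Y := inner (p j) (p j')) :
  inner v v + h ^+ 2 = 1 -> inner v' v' + h' ^+ 2 = 1 ->
  1 / 2 <= h -> cell j v -> 1 / 2 <= h' -> cell j' v' ->
  -1 <= X <= 1 -> -1 <= Y <= 1 -> `|acos Y - acos X| <= zeta3 R.
Proof.
move=> vh vh' h1 vj h1' vj'; rewrite /Y inner_simplex => X1.
have [jj|jj] := eqVneq j j' => Y1; last first.
  by apply: (@acos_dist_le _ _ _ 0) => //; lra.
apply: (@acos_dist_le _ _ _ 0) => //; try lra.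
right; move: vj'; rewrite -jj => /(cell_inner vj).
(* Here the cut at height 1/2 is sharp: (h^2 + h'^2)/3 + h h' is at least 5/12, which raises -2/3 to
   exactly -1/4. *)
have : 0 <= (h - 1 / 2) * (h' - 1 / 2) by rewrite mulr_ge0// subr_ge0.
have := sqr_ge0 (h - 1 / 2); have := sqr_ge0 (h' - 1 / 2).
by rewrite /X; lra.
Qed.

Lemma assigned_dist v h q v' h' q' :
  inner v v + h ^+ 2 = 1 -> inner v' v' + h' ^+ 2 = 1 ->
  assigned v h q -> assigned v' h' q' -> h != 0 -> h' != 0 ->
  -1 <= inner v v' + h * h' <= 1 -> -1 <= inner q q' <= 1 ->
  `|acos (inner q q') - acos (inner v v' + h * h')| <= zeta3 R.
Proof.
move=> vh vh'.
case=> [->|j k h0 h1 jk vjk ->|j h1 vj ->]; rewrite ?eqxx//;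
  (case=> [->|j' k' h0' h1' jk' vjk' ->|j' h1' vj' ->]; rewrite ?eqxx//) => _ _.
- by apply: low_low; rewrite ?(ltW h0) ?(ltW h0').
- by apply: low_high; rewrite ?(ltW h0).
- rewrite (innerC v) (innerC (p j)) (mulrC h); apply: low_high => //; exact: ltW.
- exact: high_high.
Qed.

End Cells.

(** * Gromov-Hausdorff distance and correspondences *)

Section GromovHausdorff.
Local Open Scope classical_set_scope.

(** The parameter [d] bounds half the distortion; its positivity keeps the two spaces apart once
    they are glued. *)
Record correspondence (R : realType) (X Y : metricType R) (d : R) := Correspondence {
  corr_rel :> X -> Y -> Prop ;
  corr_pos : 0 < d ;
  corr_left : forall x, exists y, corr_rel x y ;
  corr_right : forall y, exists x, corr_rel x y ;
  corr_dist : forall x y x' y', corr_rel x y -> corr_rel x' y' ->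
    `|mdist x x' - mdist y y'| <= 2 * d }.

Definition glued (R : realType) (X Y : metricType R) (d : R)
  (C : correspondence X Y d) := (X + Y)%type.

(** * Gluing two spaces along a correspondence *)

Section Glued.
Context {R : realType} {X Y : metricType R} {d : R} (C : correspondence X Y d).
Implicit Types (x : X) (y : Y).

HB.instance Definition _ := Choice.copy (glued C) (X + Y)%type.

Let cross_set x y := [set r | exists x' y', C x' y' /\ r = mdist x x' + mdist y y' + d].

(** The length of a shortest path from [x] to [y] that crosses one bridge of length [d] between
    corresponding points. *)
Let cross x y : R := inf (cross_set x y).

Let cross_lb x y x' y' : C x' y' -> cross x y <= mdist x x' + mdist y y' + d.
Proof.
move=> c; apply: ge_inf; last by exists x', y'.
exists d => _ [a [b [_ ->]]].
by rewrite lerDr addr_ge0// mdist_ge0.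
Qed.

Let le_cross x y r : (forall x' y', C x' y' -> r <= mdist x x' + mdist y y' + d) ->
  r <= cross x y.
Proof.
move=> h; apply: lb_le_inf => [|_ [a [b [/h ab ->]]]//].
have [y' c] := corr_left C x.
by exists (mdist x x + mdist y y' + d), x, y'.
Qed.

Let cross_ge x y : d <= cross x y.
Proof. by apply: le_cross => x' y' _; rewrite lerDr addr_ge0// mdist_ge0. Qed.

Definition glued_dist (a b : glued C) : R :=
  match a, b with
  | inl x, inl x' => mdist x x'
  | inr y, inr y' => mdist y y'
  | inl x, inr y | inr y, inl x => cross x y
  end.

Lemma glued_distxx a : glued_dist a a = 0.
Proof. by case: a => z /=; rewrite mdistxx. Qed.

Lemma glued_dist_positivity a b : glued_dist a b = 0 -> a = b.
Proof.
have d0 := corr_pos C.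
case: a b => [x|y] [x'|y'] /=.
- by move=> /mdist_positivity ->.
- by move=> e; have := cross_ge x y'; rewrite e leNgt d0.
- by move=> e; have := cross_ge x' y; rewrite e leNgt d0.
- by move=> /mdist_positivity ->.
Qed.

Lemma glued_dist_sym a b : glued_dist a b = glued_dist b a.
Proof. by case: a b => [x|y] [x'|y'] //=; rewrite metric_sym. Qed.

Let cross_triangle_l x x' y : cross x y <= mdist x x' + cross x' y.
Proof.
rewrite -lerBlDl; apply: le_cross => a b c.
by have := cross_lb x y c; have := metric_triangle x x' a; lra.
Qed.

Let cross_triangle_r x y y' : cross x y <= mdist y y' + cross x y'.
Proof.
rewrite -lerBlDl; apply: le_cross => a b c.
by have := cross_lb x y c; have := metric_triangle y y' b; lra.
Qed.

(** The two bridges contribute [2 * d], which pays for the distortion between the corresponding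
    pairs. *)
Let cross_cross_l x x' y : mdist x x' <= cross x y + cross x' y.
Proof.
rewrite -lerBlDr; apply: le_cross => a b c.
rewrite lerBlDr -lerBlDl; apply: le_cross => a' b' c'.
have := corr_dist c c'; rewrite ler_distl => /andP[_].
have := metric_triangle x a x'; have := metric_triangle a a' x'.
have := metric_triangle b y b'; rewrite (metric_sym b y) (metric_sym a' x'); lra.
Qed.

Let cross_cross_r x y y' : mdist y y' <= cross x y + cross x y'.
Proof.
rewrite -lerBlDr; apply: le_cross => a b c.
rewrite lerBlDr -lerBlDl; apply: le_cross => a' b' c'.
have := corr_dist c c'; rewrite ler_distl => /andP[+ _].
have := metric_triangle y b y'; have := metric_triangle b b' y'.
have := metric_triangle a x a'; rewrite (metric_sym a x) (metric_sym b' y'); lra.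
Qed.

Lemma glued_dist_triangle b a c : glued_dist a c <= glued_dist a b + glued_dist b c.
Proof.
case: a b c => [x|y] [x'|y'] [x''|y''] /=.
- exact: metric_triangle.
- exact: cross_triangle_l.
- exact: cross_cross_l.
- by rewrite addrC (metric_sym y'); exact: cross_triangle_r.
- by rewrite addrC (metric_sym x'); exact: cross_triangle_l.
- exact: cross_cross_r.
- exact: cross_triangle_r.
- exact: metric_triangle.
Qed.

HB.instance Definition _ := isMetric.Build R (glued C) glued_distxx
  glued_dist_positivity glued_dist_sym glued_dist_triangle.

Lemma gromov_hausdorff_le : (gromov_hausdorff X Y <= d%:E)%E.
Proof.
pose f (x : X) : glued C := inl x; pose g (y : Y) : glued C := inr y.
apply: ge_ereal_inf; exists (hausdorff_dist (range f) (range g)).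
  exists (glued C : metricType R), (range f), (range g); split=> //.
  - exists f; split=> //; split.
    + by move=> x _; exists x.
    + by move=> x x' _ _ [].
    + by move=> _ [x _ <-]; exists x.
  - exists g; split=> //; split.
    + by move=> x _; exists x.
    + by move=> x x' _ _ [].
    + by move=> _ [x _ <-]; exists x.
have fg x y : C x y -> mdist (f x) (g y) <= d.
  move=> c; apply: le_trans (cross_lb x y c) _.
  by rewrite !mdistxx !add0r.
rewrite /hausdorff_dist ge_max; apply/andP; split; apply: ge_ereal_sup.
  move=> _ [_ [x _ <-] <-]; have [y c] := corr_left C x.
  apply: ge_ereal_inf; exists (mdist (f x) (g y))%:E; first by exists (g y); [exists y|].
  by rewrite lee_fin fg.
move=> _ [_ [y _ <-] <-]; have [x c] := corr_right C y.
apply: ge_ereal_inf; exists (mdist (g y) (f x))%:E; first by exists (f x); [exists x|].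
by rewrite lee_fin metric_sym fg.
Qed.

End Glued.

(** In a common space at Hausdorff distance below [c / 2], sending each point of [Y] to a nearby
    point of [X] gives a map of distortion below [c]. *)
Lemma gromov_hausdorff_ge (R : realType) (X Y : metricType R) (c : R) :
  (forall (psi : Y -> X) e,
    (forall u v, `|mdist (psi u) (psi v) - mdist u v| <= e) -> c <= e) ->
  ((1 / 2 * c)%:E <= gromov_hausdorff X Y)%E.
Proof.
move=> hc; apply/ereal_infP => _ [Z [A [B [[f [fA fd]] [g [gB gd]] ->]]]].
rewrite leNgt; apply/negP => hlt.
have [e [he ec]] : exists e : R, (hausdorff_dist A B <= e%:E)%E /\ e < 1 / 2 * c.
  case: (hausdorff_dist A B) hlt => [r|//|_]; last first.
    by exists (1 / 2 * c - 1); rewrite leNye; split => //; lra.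
  by rewrite lte_fin => rc; exists r.
(* The infimum defining [dist_set] may not be attained, so a little room is left between [e] and
   [c / 2]. *)
pose e' := (e + 1 / 2 * c) / 2; have ee' : e < e' by rewrite /e'; lra.
have near y : exists x, mdist (g y) (f x) < e'.
  have gyB : B (g y) by have [fun_g _ _] := gB; exact: fun_g.
  have : (dist_set (g y) A < e'%:E)%E.
    apply: le_lt_trans (_ : (e%:E < e'%:E)%E); last by rewrite lte_fin.
    apply: le_trans he; rewrite /hausdorff_dist le_max; apply/orP; right.
    by apply: ereal_sup_ubound; exists (g y).
  move=> /ereal_inf_lt[_ [a Aa <-]]; rewrite lte_fin => lt_a.
  have [_ _ /(_ a Aa)[x _ fx]] := fA.
  by exists x; rewrite fx.
have [psi psiP] := choice near.
have : c <= 2 * e'.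
  apply: (hc psi) => u v; rewrite ler_distl.
  rewrite -fd -gd.
  have := psiP u; have := psiP v.
  have := metric_triangle (f (psi u)) (g u) (f (psi v)).
  have := metric_triangle (g u) (g v) (f (psi v)).
  have := metric_triangle (g u) (f (psi u)) (g v).
  have := metric_triangle (f (psi u)) (f (psi v)) (g v).
  rewrite (metric_sym (f (psi u)) (g u)) (metric_sym (f (psi v)) (g v)).
  move=> ? ? ? ? ? ?; apply/andP; split; lra.
rewrite /e'; lra.
Qed.

End GromovHausdorff.

(** * The correspondence between the 3-sphere and the 4-sphere *)

Section SphereMaps.
Variable R : realType.

Lemma sphere_opp_subproof k (u : sphere R k) :
  \sum_(i < k.+1) (- sphere_val u) ord0 i ^+ 2 == 1.
Proof. by rewrite -inner_sqr_sum innerNl innerNr opprK inner_sphere. Qed.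

Definition sphere_opp k (u : sphere R k) := Sphere (sphere_opp_subproof u).

Definition horiz k (x : 'rV[R]_k.+1) : 'rV[R]_k :=
  \row_i x ord0 (widen_ord (leqnSn k) i).

Definition height k (x : 'rV[R]_k.+1) : R := x ord0 ord_max.

Lemma inner_horiz k (x y : 'rV[R]_k.+1) :
  inner x y = inner (horiz x) (horiz y) + height x * height y.
Proof.
rewrite {1}/inner big_ord_recr /=; congr (_ + _).
by apply: eq_bigr => i _; rewrite !mxE.
Qed.

Lemma heightN k (x : 'rV[R]_k.+1) : height (- x) = - height x.
Proof. by rewrite /height mxE. Qed.

Definition equator k (x : 'rV[R]_k.+1) : 'rV[R]_k.+2 :=
  \row_(i < k.+2) if (i < k.+1)%N then x ord0 (inord i) else 0.

Lemma horiz_equator k (x : 'rV[R]_k.+1) : horiz (equator x) = x.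
Proof. by apply/rowP => i; rewrite !mxE /= ltn_ord inord_val. Qed.

Lemma height_equator k (x : 'rV[R]_k.+1) : height (equator x) = 0.
Proof. by rewrite /height mxE /= ltnn. Qed.

Lemma equator_subproof k (u : sphere R k) :
  \sum_(i < k.+2) equator u ord0 i ^+ 2 == 1.
Proof.
rewrite -inner_sqr_sum inner_horiz horiz_equator height_equator.
by rewrite mul0r addr0 inner_sphere.
Qed.

Definition sphere_equator k (u : sphere R k) := Sphere (equator_subproof u).

End SphereMaps.

(** * Antipodal extension and distortion of the correspondence *)

Section Correspondence34.
Variable R : realType.
Implicit Types (q : sphere R 3) (u : sphere R 4).

Definition upper_rel q u := assigned (horiz u) (height u) q.

Definition rel34 q u := upper_rel q u \/ upper_rel (sphere_opp q) (sphere_opp u).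

Let sphere_horiz u : inner (horiz u) (horiz u) + height u ^+ 2 = 1.
Proof. by rewrite expr2 -inner_horiz inner_sphere. Qed.

Lemma mdist_equator q q' :
  mdist (sphere_equator q) (sphere_equator q') = mdist q q'.
Proof.
by rewrite !mdist_sphereE inner_horiz !horiz_equator !height_equator mul0r addr0.
Qed.

Lemma mdist_upper_le q u : upper_rel q u -> mdist (sphere_equator q) u <= zeta3 R.
Proof.
move=> qu; have /andP[z2 _] := zeta3_itv R; apply: le_trans z2.
rewrite mdist_sphereE.
apply: acos_le; first exact: (inner_sphere_itv (sphere_equator q) u).
  by have := pi_gt0 R; lra.
left; rewrite cos_pihalf inner_horiz horiz_equator height_equator mul0r addr0.
by rewrite innerC; exact: inner_assigned_ge0 qu.
Qed.

Lemma upper_rel_equator q u : upper_rel q u -> height u = 0 ->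
  u = sphere_equator q.
Proof.
move=> qu h0; have qE : sphere_val q = horiz u.
  by case: qu => [//|j k h1|j h1]; exfalso; move: h1; rewrite h0; lra.
apply/val_inj/rowP => i; rewrite /= qE !mxE.
have [i4|i4] := ltnP i 4; last first.
  rewrite -h0 /height; congr (sphere_val u _ _); apply: val_inj => /=.
  by have := ltn_ord i; lia.
by congr (sphere_val u _ _); apply: val_inj; rewrite /= inordK.
Qed.

(** On the equator [u'] is [q'] itself, so only the move from [u] to the equatorial copy of [q]
    matters; it costs at most [zeta3]. *)
Lemma upper_rel_dist0 q u q' u' : upper_rel q u -> upper_rel q' u' ->
  height u' = 0 -> `|mdist q q' - mdist u u'| <= zeta3 R.
Proof.
move=> qu qu' /(upper_rel_equator qu') ->; rewrite -mdist_equator.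
set a := sphere_equator q; set b := sphere_equator q'.
have := mdist_upper_le qu; rewrite -/a => au; rewrite ler_distl.
have := metric_triangle a u b; have := metric_triangle u a b.
by rewrite (metric_sym u a) => ? ?; apply/andP; split; lra.
Qed.

Lemma upper_rel_dist q u q' u' : upper_rel q u -> upper_rel q' u' ->
  `|mdist q q' - mdist u u'| <= zeta3 R.
Proof.
move=> qu qu'; have [h0'|h0'] := eqVneq (height u') 0.
  exact: upper_rel_dist0 qu qu' h0'.
have [h0|h0] := eqVneq (height u) 0.
  by rewrite (metric_sym q) (metric_sym u); exact: upper_rel_dist0 qu' qu h0.
rewrite !mdist_sphereE (inner_horiz u); apply: assigned_dist => //.
- by rewrite -inner_horiz; exact: inner_sphere_itv.
- exact: inner_sphere_itv.
Qed.

Lemma mdist_oppl k (u v : sphere R k) : mdist (sphere_opp u) v = pi - mdist u v.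
Proof. by rewrite !mdist_sphereE innerNl acosN// inner_sphere_itv. Qed.

Lemma mdist_oppr k (u v : sphere R k) : mdist u (sphere_opp v) = pi - mdist u v.
Proof. by rewrite metric_sym mdist_oppl metric_sym. Qed.

(* The helmet trick again: [pi - d] and [pi - d'] are as far apart as [d], [d']. *)
Lemma rel34_dist q u q' u' : rel34 q u -> rel34 q' u' ->
  `|mdist q q' - mdist u u'| <= zeta3 R.
Proof.
move=> [qu|qu] [qu'|qu']; have := upper_rel_dist qu qu';
  rewrite ?mdist_oppl ?mdist_oppr => //; rewrite ?subKr//.
- by rewrite distrC; congr (`|_| <= _); ring.
- by rewrite distrC; congr (`|_| <= _); ring.
Qed.

Lemma rel34_left q : exists u, rel34 q u.
Proof.
exists (sphere_equator q); left; apply: Equator; first exact: height_equator.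
by rewrite horiz_equator.
Qed.

Lemma upper_rel_exists u : 0 <= height u -> exists q, upper_rel q u.
Proof.
move=> h0; have [q qu] := assigned_exists (sphere_horiz u) h0.
have q1 : \sum_(i < 4) q ord0 i ^+ 2 == 1.
  by rewrite -inner_sqr_sum (assigned_unit (sphere_horiz u) qu).
by exists (Sphere q1).
Qed.

Lemma sphere_oppK k : involutive (@sphere_opp R k).
Proof. by move=> u; apply: val_inj; rewrite /= opprK. Qed.

Lemma rel34_right u : exists q, rel34 q u.
Proof.
have [h0|h0] := leP 0 (height u).
  by have [q qu] := upper_rel_exists h0; exists q; left.
have [|q qu] := @upper_rel_exists (sphere_opp u).
  by rewrite /= heightN oppr_ge0 ltW.
by exists (sphere_opp q); right; rewrite sphere_oppK.
Qed.

Lemma zeta3_half_gt0 : 0 < zeta3 R / 2.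
Proof. by have := pi_gt0 R; have /andP[+ _] := zeta3_itv R; lra. Qed.

Definition corr34 : correspondence (sphere R 3) (sphere R 4) (zeta3 R / 2).
Proof.
refine (Correspondence zeta3_half_gt0 rel34_left rel34_right _).
by move=> q u q' u' qu qu'; rewrite mulrC divfK//; exact: rel34_dist.
Defined.

End Correspondence34.

Theorem theorem1p5 (R : realType) :
  gromov_hausdorff (sphere R 3) (sphere R 4) = (1 / 2 * acos (-1 / 4))%:E.
Proof.
have zE : acos (-1 / 4) = zeta3 R by rewrite /zeta3 mulNr.
apply/eqP; rewrite eq_le; apply/andP; split.
  by rewrite zE mul1r mulrC; exact: gromov_hausdorff_le (corr34 R).
apply: gromov_hausdorff_ge => psi e he.
by rewrite mulNr div1r; exact: sphere_distortion_ge he.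
Qed.
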